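(* Consider three falling balls with masses satisfying $m_1>m_2\ge m_3>0$ and $2\sqrt{m_1}\sqrt{m_3}=\sqrt{m_1+m_2}\,\sqrt{m_2+m_3}$, on a fixed energy level $c>0$. The set of least expanding points of $\mathcal{M}^+$ has full $\mu$-measure and is arcwise connected.
   Context: **System.** Three point particles (balls) with masses $m_1,m_2,m_3$, positions $0\le q_1\le q_2\le q_3$, momenta $p_i$ and velocities $v_i=p_i/m_i$ have Hamiltonian $H(q,p)=\sum_{i=1}^3\bigl(\frac{p_i^2}{2m_i}+m_iq_i\bigr)$. Between collisions $\dot q_i=p_i/m_i$, $\dot p_i=-m_i$; the flow is $\phi^t$ on $\{H=c\}\cap\{0\le q_1\le q_2\le q_3\}$. Collisions are elastic: at the floor ($q_1=0$), $v_1^+=-v_1^-$; when $q_i=q_{i+1}$ ($i=1,2$), $v_i^+=\gamma_iv_i^-+(1-\gamma_i)v_{i+1}^-$ and $v_{i+1}^+=(1+\gamma_i)v_i^--\gamma_iv_{i+1}^-$, with $\gamma_i=\frac{m_i-m_{i+1}}{m_i+m_{i+1}}$. Let $\Phi$ denote the collision map (position unchanged, velocities before $\mapsto$ velocities after). **Poincaré section and map.** On $\{H=c,\ 0\le q_1\le q_2\le q_3\}$ set $\mathcal{M}_1^+=\{q_1=0,\ v_1\ge 0\}$, $\mathcal{M}_i^+=\{q_{i-1}=q_i,\ v_{i-1}\le v_i\}$ for $i=2,3$, and $\mathcal{M}^+=\bigcup_i\mathcal{M}_i^+$ (states right after a collision). Analogously $\mathcal{M}_1^-=\{q_1=0,\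 v_1<0\}$, $\mathcal{M}_i^-=\{q_{i-1}=q_i,\ v_{i-1}>v_i\}$, $\mathcal{M}^-=\bigcup_i\mathcal{M}_i^-$. With $\tau$ the first hitting time of $\mathcal{M}^-$, $T=\Phi\circ\phi^{\tau}:\mathcal{M}^+\to\mathcal{M}^+$. The Liouville volume, restricted to the energy level and contracted with the Hamiltonian vector field, gives a smooth $T$-invariant measure $\mu$ on $\mathcal{M}^+$. On states whose next collision is a triple collision, or a simultaneous collision of the lower two balls with the floor, $T$ has two images (the simultaneous collisions performed in either order); such orbits are continued along both branches separately and statements are understood for each branch. **Tangent coordinates.** Put $h_i=\frac{p_i^2}{2m_i}+m_iq_i$, $\xi=A^{-1}h$, $\eta=A^{T}v$, where $A$ is the matrix with columns $\frac{1}{m_1+m_2+m_3}(m_1,m_2,m_3)^T$, $(1,-1,0)^T$, $(0,1,-1)^T$; then $\xi_1=H$ and the Hamiltonian field is $-\partial_{\eta_1}$. The tangent space of the energy level modulo the flow direction is identified with $L_1\oplus L_2$, where $L_1=\{(\delta\xi,0):\delta\xi_1=0\}$ and $L_2=\{(0,\delta\eta):\delta\eta_1=0\}$ in $\mathbb{R}^3\times\mathbb{R}^3$; thus on it $\delta\xi_2=\delta h_1$, $\delta\xi_3=\delta h_1+\delta h_2$, $\delta\eta_2=\delta v_1-\delta v_2$, $\delta\eta_3=\delta v_2-\delta v_3$. The derivative $d_xT$ is regarded as a linear map of $L_1\oplus L_2$. The flow acts as the identity, so $d_xT$ is the derivative of the collision that occurs: - floor: $\delta\eta_2\mapsto\delta\eta_2+\beta\,\delta\xi_2$,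 other coordinates unchanged, $\beta=-\frac{2}{m_1v_1^-}$; - balls 1,2: $\delta\xi_2\mapsto-\delta\xi_2+(1+\gamma_1)\delta\xi_3-\alpha_1\delta\eta_2$, $\delta\xi_3\mapsto\delta\xi_3$, $\delta\eta_2\mapsto-\delta\eta_2$, $\delta\eta_3\mapsto(1+\gamma_1)\delta\eta_2+\delta\eta_3$; - balls 2,3: $\delta\xi_2\mapsto\delta\xi_2$, $\delta\xi_3\mapsto(1-\gamma_2)\delta\xi_2-\delta\xi_3-\alpha_2\delta\eta_3$, $\delta\eta_2\mapsto\delta\eta_2+(1-\gamma_2)\delta\eta_3$, $\delta\eta_3\mapsto-\delta\eta_3$; here $\alpha_i=\frac{2m_im_{i+1}(m_i-m_{i+1})(v_i^--v_{i+1}^-)}{(m_i+m_{i+1})^2}$. $d_xT^{n}$ is the composition along the orbit. **Least expansion.** $Q(\delta\xi,\delta\eta)=\sum_{i=1}^3\delta\xi_i\delta\eta_i$ and $\mathcal{C}(x)=\{w\in L_1\oplus L_2: Q(w)>0\}\cup\{\vec0\}$. For $n\ge1$, $\sigma(d_xT^n)=\inf_{w\in\mathcal{C}(x)\setminus\{\vec0\}}\sqrt{\frac{Q(d_xT^nw)}{Q(w)}}$. A point $x\in\mathcal{M}^+$ is called least expanding if there exists $n=n(x)\ge1$ with $\sigma(d_xT^n)>1$. *)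

(* Defs.v *)
From HB Require Import structures.
From mathcomp Require Export all_boot all_order all_algebra.
From mathcomp Require Export all_classical all_reals all_analysis.
From mathcomp Require Export measurable_realfun.
Export Order.TTheory GRing.Theory Num.Theory.
Export numFieldNormedType.Exports.

Set Implicit Arguments.
Unset Strict Implicit.
Unset Printing Implicit Defensive.

Local Open Scope classical_set_scope.
Local Open Scope ring_scope.

Definition i1 : 'I_3 := @Ordinal 3 0 isT.
Definition i2 : 'I_3 := @Ordinal 3 1 isT.
Definition i3 : 'I_3 := @Ordinal 3 2 isT.

Definition row3 (R : realType) (a b c : R) : 'rV[R]_3 :=
  \row_k nth 0 [:: a; b; c] k.

(* A phase point x is the pair (q, p) = (x.1, x.2) of positions and momenta;
   the masses are m i1, m i2, m i3.                                           *)
Definition state (R : realType) : Type := ('rV[R]_3 * 'rV[R]_3)%type.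

Definition pos (R : realType) (x : state R) (i : 'I_3) : R := x.1 ord0 i.

Definition mom (R : realType) (x : state R) (i : 'I_3) : R := x.2 ord0 i.

Definition vel (R : realType) (m : 'I_3 -> R) (x : state R) (i : 'I_3) : R :=
  mom x i / m i.

Definition hamiltonian (R : realType) (m : 'I_3 -> R) (x : state R) : R :=
  \sum_(i < 3) (mom x i ^+ 2 / (2 * m i) + m i * pos x i).

Definition energy_level (R : realType) (m : 'I_3 -> R) (c : R) :
  set (state R) :=
  [set x | hamiltonian m x = c /\
    [/\ 0 <= pos x i1, pos x i1 <= pos x i2 & pos x i2 <= pos x i3]].

(* The solution of q_i' = p_i / m_i, p_i' = - m_i starting at x.             *)
Definition free_flow (R : realType) (m : 'I_3 -> R) (t : R) (x : state R) :
  state R :=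
  (\row_i (pos x i + t * vel m x i - t ^+ 2 / 2), \row_i (mom x i - t * m i)).

Inductive collision : Type := Floor | Balls12 | Balls23.

Definition gamma (R : realType) (m : 'I_3 -> R) (i j : 'I_3) : R :=
  (m i - m j) / (m i + m j).

(* The collision map: the velocities v after the collision are prescribed and
   converted back to momenta.                                                 *)
Definition collision_map (R : realType) (m : 'I_3 -> R) (k : collision)
    (x : state R) : state R :=
  let v := vel m x in
  let g1 := gamma m i1 i2 in
  let g2 := gamma m i2 i3 in
  let vplus : 'rV[R]_3 :=
    match k with
    | Floor => row3 (- v i1) (v i2) (v i3)
    | Balls12 => row3 (g1 * v i1 + (1 - g1) * v i2)
                      ((1 + g1) * v i1 - g1 * v i2)
                      (v i3)
    | Balls23 => row3 (v i1)
                      (g2 * v i2 + (1 - g2) * v i3)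
                      ((1 + g2) * v i2 - g2 * v i3)
    end in
  (x.1, \row_i (m i * vplus ord0 i)).

Definition after_collision (R : realType) (m : 'I_3 -> R) (c : R)
    (k : collision) : set (state R) :=
  [set x | energy_level m c x /\
    match k with
    | Floor => pos x i1 = 0 /\ 0 <= vel m x i1
    | Balls12 => pos x i1 = pos x i2 /\ vel m x i1 <= vel m x i2
    | Balls23 => pos x i2 = pos x i3 /\ vel m x i2 <= vel m x i3
    end].

Definition before_collision (R : realType) (m : 'I_3 -> R) (c : R)
    (k : collision) : set (state R) :=
  [set x | energy_level m c x /\
    match k with
    | Floor => pos x i1 = 0 /\ vel m x i1 < 0
    | Balls12 => pos x i1 = pos x i2 /\ vel m x i2 < vel m x i1
    | Balls23 => pos x i2 = pos x i3 /\ vel m x i3 < vel m x i2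
    end].

Definition section_plus (R : realType) (m : 'I_3 -> R) (c : R) :
  set (state R) := \bigcup_k after_collision m c k.

Definition section_minus (R : realType) (m : 'I_3 -> R) (c : R) :
  set (state R) := \bigcup_k before_collision m c k.

(* z = phi^tau x for the first hitting time tau >= 0 of M^-.  The value tau = 0
   occurs when x lies in several faces and another of its simultaneous
   collisions has still to be performed.                                      *)
Definition first_hit (R : realType) (m : 'I_3 -> R) (c : R)
    (x z : state R) : Prop :=
  exists tau : R, [/\ 0 <= tau,
    z = free_flow m tau x,
    section_minus m c z &
    forall s : R, 0 <= s < tau ->
      energy_level m c (free_flow m s x) /\
      ~ section_minus m c (free_flow m s x)].

(* T as a relation: y is an image of x, reached through the pre-collision
   state z and the collision k.  If z lies in several faces of M^-, each of
   them gives an image of x (the collision performed first), so the branches of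
   a multiple collision correspond to the choices of k.  For a simultaneous
   Floor and Balls23 collision both orders lead to the same state, with the
   same derivative.                                                           *)
Definition poincare_step (R : realType) (m : 'I_3 -> R) (c : R)
    (x z : state R) (k : collision) (y : state R) : Prop :=
  [/\ first_hit m c x z, before_collision m c k z & y = collision_map m k z].

(* Tangent vectors are pairs w = (delta xi, delta eta) in the coordinates
   xi = A^-1 h, eta = A^T v.  On L1 (+) L2 the components i2 and i3 are
   (dh1, dh1 + dh2) for delta xi and (dv1 - dv2, dv2 - dv3) for delta eta.    *)
Definition tangent (R : realType) : Type := ('rV[R]_3 * 'rV[R]_3)%type.

Definition L1L2 (R : realType) : set (tangent R) :=
  [set w : tangent R | w.1 ord0 i1 = 0 /\ w.2 ord0 i1 = 0].

Definition beta (R : realType) (m : 'I_3 -> R) (z : state R) : R :=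
  - (2 / (m i1 * vel m z i1)).

Definition alpha (R : realType) (m : 'I_3 -> R) (z : state R) (i j : 'I_3) :
  R :=
  2 * m i * m j * (m i - m j) * (vel m z i - vel m z j) / (m i + m j) ^+ 2.

(* d_x T for a collision k with pre-collision state z; the free flow acts as
   the identity in these coordinates.                                         *)
Definition dcollision (R : realType) (m : 'I_3 -> R) (k : collision)
    (z : state R) (w : tangent R) : tangent R :=
  let xi := w.1 ord0 in
  let eta := w.2 ord0 in
  let g1 := gamma m i1 i2 in
  let g2 := gamma m i2 i3 in
  match k with
  | Floor =>
      (w.1, row3 (eta i1) (eta i2 + beta m z * xi i2) (eta i3))
  | Balls12 =>
      (row3 (xi i1)
            (- xi i2 + (1 + g1) * xi i3 - alpha m z i1 i2 * eta i2)
            (xi i3),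
       row3 (eta i1) (- eta i2) ((1 + g1) * eta i2 + eta i3))
  | Balls23 =>
      (row3 (xi i1)
            (xi i2)
            ((1 - g2) * xi i2 - xi i3 - alpha m z i2 i3 * eta i3),
       row3 (eta i1) (eta i2 + (1 - g2) * eta i3) (- eta i3))
  end.

(* d_x T^n along the collisions k 0, ..., k (n - 1) with pre-collision states
   z 0, ..., z (n - 1).                                                       *)
Fixpoint dorbit (R : realType) (m : 'I_3 -> R) (z : nat -> state R)
    (k : nat -> collision) (n : nat) (w : tangent R) : tangent R :=
  if n is n'.+1 then dcollision m (k n') (z n') (dorbit m z k n' w) else w.

Definition Qform (R : realType) (w : tangent R) : R :=
  \sum_(i < 3) w.1 ord0 i * w.2 ord0 i.

Definition cone (R : realType) : set (tangent R) :=
  [set w : tangent R | L1L2 w /\ 0 < Qform w] `|` [set (0, 0)].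

Definition sigma (R : realType) (D : tangent R -> tangent R) : R :=
  inf [set Num.sqrt (Qform (D w) / Qform w) | w in @cone R `\ (0, 0)].

(* (y, z, k) is a branch of the orbit of x under the relation T, maximal in the
   sense that it stops only at a point without image (e.g. q_1 = v_1 = 0);
   beyond such a point the sequences carry no information.                    *)
Definition branch (R : realType) (m : 'I_3 -> R) (c : R) (x : state R)
    (y z : nat -> state R) (k : nat -> collision) : Prop :=
  y 0%N = x /\
  forall n : nat,
    (exists z' k' y', poincare_step m c (y n) z' k' y') ->
    poincare_step m c (y n) (z n) (k n) (y n.+1).

(* On every branch, T^n is defined and sigma (d_x T^n) > 1 for some n >= 1;
   where T is single valued there is only one branch.                         *)
Definition least_expanding (R : realType) (m : 'I_3 -> R) (c : R) :
  set (state R) :=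
  [set x | section_plus m c x /\
    forall (y z : nat -> state R) (k : nat -> collision),
      branch m c x y z k ->
      exists n : nat, [/\ (1 <= n)%N,
        forall j : nat, (j < n)%N ->
          poincare_step m c (y j) (z j) (k j) (y j.+1) &
        1 < sigma (dorbit m z k n)]].

(* Parametrisation of the interior of the face M_k^+ by four real parameters:
     Floor    u = (q2, p2, q3, p3), and p1 > 0 is given by H = c;
     Balls12  u = (q, P, q3, p3) with q = q1 = q2, P = p1 + p2, and the relative
              velocity v2 - v1 > 0 is given by H = c;
     Balls23  u = (q1, p1, q, P) with q = q2 = q3, P = p2 + p3, and the relative
              velocity v3 - v2 > 0 is given by H = c.
   face_kinetic is the kinetic energy of ball 1, resp. the kinetic energy of the
   colliding pair in its centre-of-mass frame.                                *)
Definition face_kinetic (R : realType) (m : 'I_3 -> R) (c : R)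
    (k : collision) (u1 u2 u3 u4 : R) : R :=
  match k with
  | Floor =>
      c - (u2 ^+ 2 / (2 * m i2) + m i2 * u1) - (u4 ^+ 2 / (2 * m i3) + m i3 * u3)
  | Balls12 =>
      c - (u2 ^+ 2 / (2 * (m i1 + m i2)) + (m i1 + m i2) * u1)
        - (u4 ^+ 2 / (2 * m i3) + m i3 * u3)
  | Balls23 =>
      c - (u2 ^+ 2 / (2 * m i1) + m i1 * u1)
        - (u4 ^+ 2 / (2 * (m i2 + m i3)) + (m i2 + m i3) * u3)
  end.

Definition face_chart (R : realType) (m : 'I_3 -> R) (c : R) (k : collision)
    (u1 u2 u3 u4 : R) : state R :=
  let K := face_kinetic m c k u1 u2 u3 u4 in
  match k with
  | Floor => (row3 0 u1 u3, row3 (Num.sqrt (2 * m i1 * K)) u2 u4)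
  | Balls12 =>
      let M := m i1 + m i2 in
      let r := Num.sqrt (2 * (m i1 * m i2 / M) * K) in
      (row3 u1 u1 u3, row3 (m i1 / M * u2 - r) (m i2 / M * u2 + r) u4)
  | Balls23 =>
      let M := m i2 + m i3 in
      let r := Num.sqrt (2 * (m i2 * m i3 / M) * K) in
      (row3 u1 u3 u3, row3 u2 (m i2 / M * u4 - r) (m i3 / M * u4 + r))
  end.

(* measurableTypeR R is R with the Borel sets, on which lebesgue_measure is
   defined.                                                                   *)
Definition R4 (R : realType) : Type :=
  (measurableTypeR R * measurableTypeR R * measurableTypeR R
     * measurableTypeR R)%type.

Definition face_domain (R : realType) (m : 'I_3 -> R) (c : R) (k : collision) :
  set (R4 R) :=
  [set u | let: (u1, u2, u3, u4) := u in
    [/\ 0 <= u1, u1 <= u3 & 0 < face_kinetic m c k u1 u2 u3 u4]].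

Definition grad_hamiltonian (R : realType) (m : 'I_3 -> R) (x : state R) :
  state R := (\row_i m i, \row_i vel m x i).

Definition hamiltonian_field (R : realType) (m : 'I_3 -> R) (x : state R) :
  state R := (\row_i vel m x i, \row_i (- m i)).

Definition sqnorm (R : realType) (x : state R) : R :=
  \sum_(i < 3) (pos x i ^+ 2 + mom x i ^+ 2).

(* The Liouville volume |dq1 dq2 dq3 dp1 dp2 dp3| of six tangent vectors.    *)
Definition liouville (R : realType) (s : seq (state R)) : R :=
  `| \det (\matrix_(i < 3 + 3)
             row_mx (nth (0, 0) s i).1 (nth (0, 0) s i).2) |.

(* The Liouville volume is restricted to {H = c} by contracting it with a
   vector Y such that dH(Y) = 1, here Y = grad H / |grad H|^2 (the restriction
   does not depend on the choice of Y); it is then contracted with the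
   Hamiltonian field and evaluated on the four partial derivatives of the
   chart.                                                                     *)
Definition face_density (R : realType) (m : 'I_3 -> R) (c : R) (k : collision)
    (u1 u2 u3 u4 : R) : R :=
  let f := face_chart m c k in
  let x := f u1 u2 u3 u4 in
  let gradH := grad_hamiltonian m x in
  liouville [:: (sqnorm gradH)^-1 *: gradH;
                hamiltonian_field m x;
                derive1 (fun s => f s u2 u3 u4) u1;
                derive1 (fun s => f u1 s u3 u4) u2;
                derive1 (fun s => f u1 u2 s u4) u3;
                derive1 (fun s => f u1 u2 u3 s) u4].

Definition lebesgue4 (R : realType) : {measure set (R4 R) -> \bar R} :=
  (@lebesgue_measure R \x @lebesgue_measure R \x @lebesgue_measure R
     \x @lebesgue_measure R)%E.

(* mu on the face M_k^+; the grazing points of the face, where the relative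
   velocity vanishes, are left out: they have dimension three.               *)
Definition mu_face (R : realType) (m : 'I_3 -> R) (c : R) (k : collision)
    (A : set (state R)) : \bar R :=
  let f := fun u : R4 R =>
    let: (u1, u2, u3, u4) := u in face_chart m c k u1 u2 u3 u4 in
  let dens := fun u : R4 R =>
    let: (u1, u2, u3, u4) := u in face_density m c k u1 u2 u3 u4 in
  (\int[lebesgue4 R]_(u in face_domain m c k `&` f @^-1` A) (dens u)%:E)%E.

Definition mu (R : realType) (m : 'I_3 -> R) (c : R) (A : set (state R)) :
  \bar R :=
  (mu_face m c Floor A + mu_face m c Balls12 A + mu_face m c Balls23 A)%E.

Definition full_measure (R : realType) (m : 'I_3 -> R) (c : R)
    (A : set (state R)) : Prop :=
  exists N : set (state R), [/\ <<s @open (state R) >> N,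
    mu m c N = 0%E & section_plus m c `\` A `<=` N].

(* The domain of a path is the interval [0, 1]; f is irrelevant outside it.  *)
Definition arcwise_connected (R : realType) (A : set (state R)) : Prop :=
  forall x y : state R, A x -> A y ->
    exists f : R -> state R, [/\ {within `[0, 1], continuous f},
      f 0 = x, f 1 = y & forall t : R, 0 <= t <= 1 -> A (f t)].

(* Main.v *)
Require Import Defs.
From mathcomp Require Import ring lra zify.

Set Implicit Arguments.
Unset Strict Implicit.
Unset Printing Implicit Defensive.

Local Open Scope classical_set_scope.
Local Open Scope ring_scope.

(** The mass condition says (1 + gamma_1)(1 - gamma_2) = 1. Hence, up to shears
    that only increase Q, the ball-ball collisions act on delta xi by two
    reflections whose product has order 3. Along a stretch floor, balls 12,
    floor, balls 23 (other collisions interspersed) the gain Q(DT^n w) - Q(w)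
    is a definite quadratic form, so that sigma > 1. Energy conservation shows
    that no tail of an infinite branch avoids one of the three collisions, so
    every infinite branch contains such a stretch.

    A branch stops only when ball 1 lies on the floor with velocity 0. After a
    ball-ball collision this is a two-dimensional set of states, and the
    inverse branches of T are pointwise Lipschitz; therefore the points that
    are not least expanding form, apart from the grazing points of the faces, a
    set of zero 3-dimensional Hausdorff measure in the four-dimensional M^+.
    So they are mu-null. Moreover the cone over them from any vertex is
    Lebesgue-null in the chart of a face; the chart domain being convex, two
    least expanding points of a face are joined by two segments through a
    generic third point. *)

(** * Free flight and collisions *)

(** Full measure alone would not give connectedness, since a hypersurface is null and can separate;
    hence the exceptional set is measured in dimension 3, one below that of [M^+]. Multiple
    collisions do not enter it: the expansion argument uses only the order of the collisions and the
    signs of relative velocities, so it works along each branch, and only orbits that stop remain.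
    With s = 1 + gamma_1 and t = 1 - gamma_2, the product of the two reflections has determinant 1
    and trace s t - 2, which the mass condition turns into -1. In the group of order 6 that they
    generate, the line xi_2 = 0 has three images: itself, xi_2 = s xi_3 and xi_3 = 0. The floor
    gains in xi_2; once a collision of balls 1 and 2 has moved the line xi_2 = 0 to one of the other
    two, the next floor collision gains in an independent direction. The relative velocities undergo
    the dual reflections, and the requirement that colliding balls approach each other keeps the
    line from returning too early. *)

Section Dynamics.
Context (R : realType) (m : 'I_3 -> R) (c : R).
Implicit Types (x y z : state R) (k : collision) (t : R).


Lemma row3E (a b d : R) :
  (row3 a b d ord0 i1 = a) * (row3 a b d ord0 i2 = b) * (row3 a b d ord0 i3 = d).
Proof. by rewrite /row3 !mxE. Qed.

Lemma all_i3 (P : 'I_3 -> Prop) : P i1 -> P i2 -> P i3 -> forall i, P i.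
Proof.
move=> P1 P2 P3 [[|[|[|i]]] hi] //.
- by rewrite (_ : Ordinal _ = i1) //; apply: val_inj.
- by rewrite (_ : Ordinal _ = i2) //; apply: val_inj.
- by rewrite (_ : Ordinal _ = i3) //; apply: val_inj.
Qed.

Lemma sum_i3 (V : nmodType) (F : 'I_3 -> V) : \sum_(i < 3) F i = F i1 + F i2 + F i3.
Proof.
rewrite !big_ord_recl big_ord0 addr0 addrA.
by congr (F _ + F _ + F _); apply: val_inj.
Qed.

Lemma state_ext x y : (forall i, pos x i = pos y i) ->
  (forall i, mom x i = mom y i) -> x = y.
Proof.
case: x y => [q p] [q' p'] hq hp; congr (_, _).
  by apply/rowP => i; have := hq i.
by apply/rowP => i; have := hp i.
Qed.

Lemma pos_free_flow t x i :
  pos (free_flow m t x) i = pos x i + t * vel m x i - t ^+ 2 / 2.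
Proof. by rewrite /pos mxE. Qed.

Lemma mom_free_flow t x i : mom (free_flow m t x) i = mom x i - t * m i.
Proof. by rewrite /mom mxE. Qed.

Lemma pos_collision k x i : pos (collision_map m k x) i = pos x i.
Proof. by []. Qed.

Lemma hamiltonianE x : hamiltonian m x =
  mom x i1 ^+ 2 / (2 * m i1) + m i1 * pos x i1 +
  (mom x i2 ^+ 2 / (2 * m i2) + m i2 * pos x i2) +
  (mom x i3 ^+ 2 / (2 * m i3) + m i3 * pos x i3).
Proof. by rewrite /hamiltonian sum_i3. Qed.

Context (m_gt0 : forall i, 0 < m i).

Lemma m_neq0 i : m i != 0. Proof. by rewrite gt_eqF. Qed.

Lemma mD_neq0 i j : m i + m j != 0. Proof. by rewrite gt_eqF ?addr_gt0. Qed.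

Lemma vel_free_flow t x i : vel m (free_flow m t x) i = vel m x i - t.
Proof. by rewrite /vel mom_free_flow mulrBl mulfK ?m_neq0. Qed.

Lemma momE x i : mom x i = m i * vel m x i.
Proof. by rewrite /vel mulrC divfK ?m_neq0. Qed.

Lemma vel_floor x : let v := vel m (collision_map m Floor x) in
  [/\ v i1 = - vel m x i1, v i2 = vel m x i2 & v i3 = vel m x i3].
Proof. by rewrite /= /vel /mom /= !mxE !(mulrC (m _)) ?mulfK ?m_neq0. Qed.

Lemma vel_balls12 x : let v := vel m (collision_map m Balls12 x) in
  let g := gamma m i1 i2 in
  [/\ v i1 = g * vel m x i1 + (1 - g) * vel m x i2,
      v i2 = (1 + g) * vel m x i1 - g * vel m x i2 & v i3 = vel m x i3].
Proof.
move=> v g; rewrite /v /vel /mom /= !mxE /=.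
by rewrite !(mulrC (m _)) ?mulfK ?m_neq0 //.
Qed.

Lemma vel_balls23 x : let v := vel m (collision_map m Balls23 x) in
  let g := gamma m i2 i3 in
  [/\ v i1 = vel m x i1, v i2 = g * vel m x i2 + (1 - g) * vel m x i3 &
      v i3 = (1 + g) * vel m x i2 - g * vel m x i3].
Proof.
move=> v g; rewrite /v /vel /mom /= !mxE /=.
by rewrite !(mulrC (m _)) ?mulfK ?m_neq0 //.
Qed.

Lemma hamiltonian_velE x : hamiltonian m x =
  m i1 * (vel m x i1 ^+ 2 / 2 + pos x i1) +
  m i2 * (vel m x i2 ^+ 2 / 2 + pos x i2) +
  m i3 * (vel m x i3 ^+ 2 / 2 + pos x i3).
Proof.
by rewrite hamiltonianE !momE; field; rewrite !m_neq0.
Qed.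

Lemma hamiltonian_free_flow t x :
  hamiltonian m (free_flow m t x) = hamiltonian m x.
Proof. by rewrite !hamiltonian_velE !pos_free_flow !vel_free_flow; field. Qed.

Lemma hamiltonian_collision k x :
  hamiltonian m (collision_map m k x) = hamiltonian m x.
Proof.
rewrite !hamiltonian_velE !pos_collision.
case: k.
- by have [-> -> ->] := vel_floor x; rewrite sqrrN.
- have [-> -> ->] := vel_balls12 x.
  by rewrite /gamma; field; rewrite mD_neq0.
- have [-> -> ->] := vel_balls23 x.
  by rewrite /gamma; field; rewrite mD_neq0.
Qed.

Lemma collision_mapK k : involutive (collision_map m k).
Proof.
move=> x; apply: state_ext => // i; rewrite !momE; congr (_ * _).
case: k; move: i; apply: all_i3.
- by have [-> _ _] := vel_floor (collision_map m Floor x);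
    have [-> _ _] := vel_floor x; rewrite opprK.
- by have [_ -> _] := vel_floor (collision_map m Floor x);
    have [_ -> _] := vel_floor x.
- by have [_ _ ->] := vel_floor (collision_map m Floor x);
    have [_ _ ->] := vel_floor x.
- by have [-> _ _] := vel_balls12 (collision_map m Balls12 x);
    have [-> -> _] := vel_balls12 x; ring.
- by have [_ -> _] := vel_balls12 (collision_map m Balls12 x);
    have [-> -> _] := vel_balls12 x; ring.
- by have [_ _ ->] := vel_balls12 (collision_map m Balls12 x);
    have [_ _ ->] := vel_balls12 x.
- by have [-> _ _] := vel_balls23 (collision_map m Balls23 x);
    have [-> _ _] := vel_balls23 x.
- by have [_ -> _] := vel_balls23 (collision_map m Balls23 x);
    have [_ -> ->] := vel_balls23 x; ring.
- by have [_ _ ->] := vel_balls23 (collision_map m Balls23 x);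
    have [_ -> ->] := vel_balls23 x; ring.
Qed.

Lemma free_flowK t x : free_flow m (- t) (free_flow m t x) = x.
Proof.
apply: state_ext => i.
  by rewrite !pos_free_flow vel_free_flow; field.
by rewrite !mom_free_flow; ring.
Qed.

(** All balls have the same acceleration, so the gaps between them are affine in time and only the
    floor gives a quadratic equation. Its larger root is [T1], and ball 1 would arrive there with
    velocity [- r]; the excluded states are those with [r = 0], for which this arrival is not in
    [M^-]. *)
Lemma first_hit_exists x : energy_level m c x ->
  ~ (pos x i1 = 0 /\ vel m x i1 = 0) -> exists z, first_hit m c x z.
Proof.
move=> [hH [q1 q12 q23]] nd.
set v := vel m x; set q := pos x.
pose T1 := v i1 + Num.sqrt (v i1 ^+ 2 + 2 * q i1).
have q1' : 0 <= q i1 by [].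
have D0 : 0 <= v i1 ^+ 2 + 2 * q i1 by have := sqr_ge0 (v i1); lra.
have sD := sqr_sqrtr D0; have sD0 := sqrtr_ge0 (v i1 ^+ 2 + 2 * q i1).
move: sD sD0 @T1; set r := Num.sqrt _ => sD r0 T1.
have rgt0 : 0 < r.
  rewrite lt_neqAle r0 andbT eq_sym; apply/eqP => r_0; apply: nd.
  have := sqr_ge0 (v i1); rewrite r_0 expr0n /= in sD => v2.
  have q_0 : q i1 = 0 by lra.
  split=> //; apply/eqP; rewrite -sqrf_eq0; apply/eqP; rewrite -/v; lra.
(* The first exit time is the minimum of the exit times of the three
   constraints; an infinite one is replaced by that of the floor. *)
pose E i j := if v j < v i then (q j - q i) / (v i - v j) else T1.
pose T := Num.min T1 (Num.min (E i1 i2) (E i2 i3)).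
have rv : `|v i1| <= r.
  rewrite -(ler_sqr (x := `|v i1|)) ?nnegrE // real_normK ?num_real //; lra.
have rv1 : v i1 <= r by exact: le_trans (ler_norm _) rv.
have rv2 : - v i1 <= r by apply: le_trans (ler_norm _) _; rewrite normrN.
have T10 : 0 <= T1 by rewrite /T1; lra.
have E0 i j : q i <= q j -> 0 <= E i j.
  by move=> h; rewrite /E; case: ifP => // h'; apply: divr_ge0; lra.
have T0 : 0 <= T by rewrite /T !le_min T10 !E0.
have Tle : [/\ T <= T1, T <= E i1 i2 & T <= E i2 i3].
  by rewrite /T !ge_min !lexx !orbT.
have fl1 s : pos (free_flow m s x) i1 = (T1 - s) * (s - v i1 + r) / 2.
  rewrite pos_free_flow -/v -/q /T1.
  have -> : q i1 = (r ^+ 2 - v i1 ^+ 2) / 2 by lra.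
  by field.
have flE i j s : pos (free_flow m s x) j - pos (free_flow m s x) i =
   (q j - q i) - s * (v i - v j) by rewrite !pos_free_flow -/v -/q; ring.
have Eeq i j : v j < v i -> q j - q i = E i j * (v i - v j).
  by rewrite /E => h; rewrite h divfK // gt_eqF // subr_gt0.
have flP i j s : q i <= q j -> 0 <= s -> s <= E i j ->
    pos (free_flow m s x) i <= pos (free_flow m s x) j.
  move=> qq s0 sE; rewrite -subr_ge0 flE; case: (ltP (v j) (v i)) => h.
    by rewrite Eeq // -mulrBl mulr_ge0 // subr_ge0 // ltW.
  have : 0 <= s * (v j - v i) by rewrite mulr_ge0 ?subr_ge0.
  by move=> h'; have : q i <= q j by []; lra.
have flow_in s : 0 <= s -> s <= T -> energy_level m c (free_flow m s x).
  case: Tle => t1 t2 t3 s0 sT; split; first by rewrite hamiltonian_free_flow.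
  split.
  - rewrite fl1 divr_ge0 ?mulr_ge0 //; lra.
  - by apply: flP => //; lra.
  - by apply: flP => //; lra.
have not_minus s : 0 <= s -> s < T -> ~ section_minus m c (free_flow m s x).
  case: Tle => t1 t2 t3 s0 sT [k _] [_].
  case: k => [] [].
  - move=> /eqP; rewrite fl1 vel_free_flow -/v.
    have -> : ((T1 - s) * (s - v i1 + r) / 2 == 0) = (s - v i1 + r == 0).
      rewrite !mulf_eq0 invr_eq0 (pnatr_eq0 R 2) orbF subr_eq0.
      by rewrite [T1 == s]gt_eqF //; lra.
    by move=> /eqP; lra.
  - move=> /eqP; rewrite eq_sym -subr_eq0 flE !vel_free_flow -/v => h hv.
    have hv' : v i2 < v i1 by lra.
    move: h; rewrite Eeq // -mulrBl mulf_eq0 !subr_eq0 => /orP[/eqP|/eqP]; lra.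
  - move=> /eqP; rewrite eq_sym -subr_eq0 flE !vel_free_flow -/v => h hv.
    have hv' : v i3 < v i2 by lra.
    move: h; rewrite Eeq // -mulrBl mulf_eq0 !subr_eq0 => /orP[/eqP|/eqP]; lra.
exists (free_flow m T x), T; split=> //; last first.
  move=> s /andP[s0 sT]; split; last exact: not_minus.
  by apply: flow_in => //; apply: ltW.
have inT := flow_in T T0 (lexx _).
have minus1 : T = T1 -> before_collision m c Floor (free_flow m T x).
  move=> TT1; split=> //; split; first by rewrite fl1 TT1 subrr !mul0r.
  by rewrite vel_free_flow -/v TT1 /T1; lra.
have [//|hn1] := eqVneq T T1; first by move=> /minus1 ?; exists Floor.
have : T = E i1 i2 \/ T = E i2 i3.
  move: hn1; rewrite /T; rewrite minElt; case: ifP => [|_]; rewrite ?eqxx //.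
  by rewrite minElt; case: ifP => _ _; [left|right].
case=> TE.
- exists Balls12 => //; split=> //; split.
    apply/eqP; rewrite eq_sym -subr_eq0 flE TE /E.
    case: ifP hn1 => [h _|h]; last by rewrite TE /E h eqxx.
    by rewrite divfK ?subrr // gt_eqF // subr_gt0.
  rewrite !vel_free_flow -/v ltrD2r.
  by case: ltP (hn1) => // h; rewrite TE /E ltNge h /= eqxx.
- exists Balls23 => //; split=> //; split.
    apply/eqP; rewrite eq_sym -subr_eq0 flE TE /E.
    case: ifP hn1 => [h _|h]; last by rewrite TE /E h eqxx.
    by rewrite divfK ?subrr // gt_eqF // subr_gt0.
  rewrite !vel_free_flow -/v ltrD2r.
  by case: ltP (hn1) => // h; rewrite TE /E ltNge h /= eqxx.
Qed.

Lemma poincare_step_exists x : energy_level m c x ->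
  ~ (pos x i1 = 0 /\ vel m x i1 = 0) ->
  exists z k y, poincare_step m c x z k y.
Proof.
move=> hx nd; have [z hz] := first_hit_exists hx nd.
case: (hz) => t [_ _ [k _ hk] _].
by exists z, k, (collision_map m k z); split.
Qed.

End Dynamics.

(** * Strict expansion *)

Section Expansion.
Context (R : realType) (m : 'I_3 -> R) (c : R).
Context (m_gt0 : forall i, 0 < m i) (hm12 : m i2 < m i1) (hm23 : m i3 < m i2).
Implicit Types (x y z : state R) (k : collision) (w : tangent R).

Let s : R := 1 + gamma m i1 i2.
Let t : R := 1 - gamma m i2 i3.
Context (st1 : s * t = 1).

Lemma s_gt0 : 0 < s.
Proof.
have m1 := m_gt0 i1; have m2 := m_gt0 i2.
rewrite /s /gamma (_ : 1 + _ = 2 * m i1 / (m i1 + m i2)).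
  by rewrite divr_gt0 // ?mulr_gt0 ?addr_gt0.
by field; rewrite mD_neq0.
Qed.

Definition gain k z w : R := match k with
  | Floor => beta m z * w.1 ord0 i2 ^+ 2
  | Balls12 => alpha m z i1 i2 * w.2 ord0 i2 ^+ 2
  | Balls23 => alpha m z i2 i3 * w.2 ord0 i3 ^+ 2
  end.

Lemma Qform_dcollision k z w :
  Qform (dcollision m k z w) = Qform w + gain k z w.
Proof.
by rewrite /Qform !sum_i3 /gain; case: k; rewrite /= !row3E; ring.
Qed.

Definition gain_coef k z : R := match k with
  | Floor => beta m z
  | Balls12 => alpha m z i1 i2
  | Balls23 => alpha m z i2 i3
  end.

Lemma gain_coef_gt0 k z : before_collision m c k z -> 0 < gain_coef k z.
Proof.
case: k => [] [_ [_ hv]] /=.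
- rewrite /beta -mulrN -invrN divr_gt0 // oppr_gt0.
  by rewrite pmulr_rlt0.
- by rewrite /alpha divr_gt0 ?exprn_gt0 ?mulr_gt0 ?subr_gt0 ?addr_gt0.
- by rewrite /alpha divr_gt0 ?exprn_gt0 ?mulr_gt0 ?subr_gt0 ?addr_gt0.
Qed.

(** Free flight preserves the relative velocities, which are the eta coordinates of the state;
    ball-ball collisions act on them as on delta eta. At the floor [e2] changes by an amount that is
    of no interest. *)
Lemma poincare_step_vel x z k y : poincare_step m c x z k y ->
  let e2 u := vel m u i1 - vel m u i2 in
  let e3 u := vel m u i2 - vel m u i3 in
  match k with
  | Floor => e3 y = e3 x
  | Balls12 => [/\ 0 < e2 x, e2 y = - e2 x & e3 y = s * e2 x + e3 x]
  | Balls23 => [/\ 0 < e3 x, e2 y = e2 x + t * e3 x & e3 y = - e3 x]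
  end.
Proof.
case=> -[T [T0 -> _ _]] [_ hk] -> e2 e3; rewrite /e2 /e3.
case: k hk => hk.
- by have [_ -> ->] := vel_floor m_gt0 (free_flow m T x);
    rewrite !vel_free_flow //; ring.
- have [-> -> ->] := vel_balls12 m_gt0 (free_flow m T x).
  by case: hk; rewrite !vel_free_flow // => _ hk; split; rewrite /s; lra.
- have [-> -> ->] := vel_balls23 m_gt0 (free_flow m T x).
  by case: hk; rewrite !vel_free_flow // => _ hk; split; rewrite /t; lra.
Qed.

Section Orbit.
Context (y z : nat -> state R) (k : nat -> collision) (n : nat).
Context (orbit_step : forall j, (j < n)%N ->
  poincare_step m c (y j) (z j) (k j) (y j.+1)).

Let D j w := dorbit m z k j w.
Let X2 j w := (D j w).1 ord0 i2.
Let X3 j w := (D j w).1 ord0 i3.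
Let Y2 j w := (D j w).2 ord0 i2.
Let Y3 j w := (D j w).2 ord0 i3.

Let N j w := Qform (D j w) - Qform w.

Lemma gainE k' z' w : gain k' z' w = gain_coef k' z' *
  (match k' with Floor => w.1 ord0 i2 | Balls12 => w.2 ord0 i2
   | Balls23 => w.2 ord0 i3 end) ^+ 2.
Proof. by case: k'. Qed.

Lemma coef_gt0 j : (j < n)%N -> 0 < gain_coef (k j) (z j).
Proof. by move=> jn; case: (orbit_step jn) => _ h _; apply: gain_coef_gt0 h. Qed.

Lemma gain_le_total i j w : (i <= j)%N -> (j <= n)%N -> N i w <= N j w.
Proof.
move=> ij jn; elim: j ij jn => [|j IH]; first by rewrite leqn0 => /eqP ->.
rewrite leq_eqVlt => /orP[/eqP -> //|ij] jn.
apply: le_trans (IH ij (ltnW jn)) _.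
rewrite lerD2r /D /= Qform_dcollision lerDl gainE.
by rewrite mulr_ge0 ?sqr_ge0 // ltW // coef_gt0.
Qed.

(* [g] is controlled by the total gain; modulo controlled functionals the
   shears of the collisions disappear and the derivative acts by reflections. *)
Definition ctrl (g : tangent R -> R) : Prop :=
  exists2 C : R, 0 <= C & forall w, g w ^+ 2 <= C * N n w.

(** By (u + v)^2 <= 2 u^2 + 2 v^2, controlled functionals are closed under linear combinations. *)
Lemma ctrl_lin (a b : R) g1 g2 g : ctrl g1 -> ctrl g2 ->
  (forall w, g w = a * g1 w + b * g2 w) -> ctrl g.
Proof.
move=> [C1 C10 h1] [C2 C20 h2] hg.
exists (2 * (a ^+ 2 * C1 + b ^+ 2 * C2)).
  by rewrite mulr_ge0 // addr_ge0 // mulr_ge0 ?sqr_ge0.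
move=> w; rewrite hg.
have e1 : a ^+ 2 * g1 w ^+ 2 <= a ^+ 2 * (C1 * N n w).
  by rewrite ler_wpM2l ?sqr_ge0.
have e2 : b ^+ 2 * g2 w ^+ 2 <= b ^+ 2 * (C2 * N n w).
  by rewrite ler_wpM2l ?sqr_ge0.
have := sqr_ge0 (a * g1 w - b * g2 w).
have -> : 2 * (a ^+ 2 * C1 + b ^+ 2 * C2) * N n w =
  2 * (a ^+ 2 * (C1 * N n w)) + 2 * (b ^+ 2 * (C2 * N n w)) by ring.
rewrite sqrrB sqrrD !exprMn; lra.
Qed.

Lemma ctrl_scale (a : R) g1 g : ctrl g1 -> (forall w, g w = a * g1 w) -> ctrl g.
Proof.
by move=> c1 hg; apply: (ctrl_lin (a := a) (b := 0) c1 c1) => w; rewrite hg mul0r addr0.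
Qed.

(** All gains are nonnegative, so that of a single collision, a positive multiple of the square of
    one coordinate, is at most the total. *)
Lemma ctrl_gain j : (j < n)%N -> ctrl (match k j with
  | Floor => X2 j | Balls12 => Y2 j | Balls23 => Y3 j end).
Proof.
move=> jn; have c0 := coef_gt0 jn.
exists (gain_coef (k j) (z j))^-1; first by rewrite invr_ge0 ltW.
move=> w; rewrite mulrC ler_pdivlMr // mulrC.
have h1 := gain_le_total w jn (leqnn n).
have h0 := gain_le_total w (leq0n j) (ltnW jn).
apply: le_trans h1; rewrite /N /D /= Qform_dcollision gainE.
move: h0; rewrite {1}/N /D /= subrr /N /D.
by rewrite /X2 /Y2 /Y3 /D; case: (k j); lra.
Qed.

Lemma orbit_coords j w : match k j with
  | Floor => [/\ X2 j.+1 w = X2 j w, X3 j.+1 w = X3 j w,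
      Y2 j.+1 w = Y2 j w + beta m (z j) * X2 j w & Y3 j.+1 w = Y3 j w]
  | Balls12 => [/\ X2 j.+1 w = - X2 j w + s * X3 j w - alpha m (z j) i1 i2 * Y2 j w,
      X3 j.+1 w = X3 j w, Y2 j.+1 w = - Y2 j w & Y3 j.+1 w = s * Y2 j w + Y3 j w]
  | Balls23 => [/\ X2 j.+1 w = X2 j w,
      X3 j.+1 w = t * X2 j w - X3 j w - alpha m (z j) i2 i3 * Y3 j w,
      Y2 j.+1 w = Y2 j w + t * Y3 j w & Y3 j.+1 w = - Y3 j w]
  end.
Proof.
by rewrite /X2 /X3 /Y2 /Y3 /D /=; case: (k j) => /=; split; rewrite ?row3E.
Qed.

Lemma ctrl_sum3 (a b d : R) g1 g2 g3 g : ctrl g1 -> ctrl g2 -> ctrl g3 ->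
  (forall w, g w = a * g1 w + b * g2 w + d * g3 w) -> ctrl g.
Proof.
move=> c1 c2 c3 hg.
apply: (ctrl_lin (g1 := fun w => a * g1 w + b * g2 w) (a := 1) (b := d) _ c3).
  exact: ctrl_lin c1 c2 _.
by move=> w; rewrite hg mul1r.
Qed.

Let e2 j := vel m (y j) i1 - vel m (y j) i2.
Let e3 j := vel m (y j) i2 - vel m (y j) i3.

Let step_vel j (jn : (j < n)%N) := poincare_step_vel (orbit_step jn).

(* The images of the line [xi_2 = 0] under the reflections; the inequalities
   between the velocities exclude a return to it before the next floor
   collision. *)
Inductive xi_state (j : nat) : Prop :=
  | XiAll of ctrl (X2 j) & ctrl (X3 j)
  | Xi1 of ctrl (fun w => X2 j w - s * X3 j w) & e2 j < 0
  | Xi2 of ctrl (X3 j) & e3 j < 0 & s * e2 j + e3 j < 0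
  | Xi3 of ctrl (X3 j) & e2 j < 0 & e3 j < 0.

Lemma XiAll_step j : (j < n)%N -> ctrl (X2 j) -> ctrl (X3 j) ->
  ctrl (X2 j.+1) /\ ctrl (X3 j.+1).
Proof.
move=> jn c2 c3; have cg := ctrl_gain jn.
have := orbit_coords j; case: (k j) cg => cg H; split.
- by apply: (ctrl_scale (a := 1) c2) => w; have [-> _ _ _] := H w; ring.
- by apply: (ctrl_scale (a := 1) c3) => w; have [_ -> _ _] := H w; ring.
- apply: (ctrl_sum3 (a := -1) (b := s) (d := - alpha m (z j) i1 i2) c2 c3 cg) => w.
  by have [-> _ _ _] := H w; ring.
- by apply: (ctrl_scale (a := 1) c3) => w; have [_ -> _ _] := H w; ring.
- by apply: (ctrl_scale (a := 1) c2) => w; have [-> _ _ _] := H w; ring.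
- apply: (ctrl_sum3 (a := t) (b := -1) (d := - alpha m (z j) i2 i3) c2 c3 cg) => w.
  by have [_ -> _ _] := H w; ring.
Qed.

(** Modulo controlled functionals a collision acts on delta xi as an involution, so the coefficients
    of the forward step serve again. *)
Lemma XiAll_back j : (j < n)%N -> ctrl (X2 j.+1) -> ctrl (X3 j.+1) ->
  ctrl (X2 j) /\ ctrl (X3 j).
Proof.
move=> jn c2 c3; have cg := ctrl_gain jn.
have := orbit_coords j; case: (k j) cg => cg H; split.
- by apply: (ctrl_scale (a := 1) c2) => w; have [-> _ _ _] := H w; ring.
- by apply: (ctrl_scale (a := 1) c3) => w; have [_ -> _ _] := H w; ring.
- apply: (ctrl_sum3 (a := -1) (b := s) (d := - alpha m (z j) i1 i2) c2 c3 cg) => w.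
  by have [-> -> _ _] := H w; ring.
- by apply: (ctrl_scale (a := 1) c3) => w; have [_ -> _ _] := H w; ring.
- by apply: (ctrl_scale (a := 1) c2) => w; have [-> _ _ _] := H w; ring.
- apply: (ctrl_sum3 (a := t) (b := -1) (d := - alpha m (z j) i2 i3) c2 c3 cg) => w.
  by have [-> -> _ _] := H w; ring.
Qed.

(** On delta eta it is the floor that shears, along [X2 j], which the same collision controls. *)
Lemma eta_back j : (j < n)%N -> ctrl (Y2 j.+1) -> ctrl (Y3 j.+1) ->
  ctrl (Y2 j) /\ ctrl (Y3 j).
Proof.
move=> jn c2 c3; have cg := ctrl_gain jn.
have := orbit_coords j; case: (k j) cg => cg H; split.
- apply: (ctrl_lin (a := 1) (b := - beta m (z j)) c2 cg) => w.
  by have [_ _ -> _] := H w; ring.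
- by apply: (ctrl_scale (a := 1) c3) => w; have [_ _ _ ->] := H w; ring.
- by apply: (ctrl_scale (a := -1) c2) => w; have [_ _ -> _] := H w; ring.
- apply: (ctrl_lin (a := s) (b := 1) c2 c3) => w.
  by have [_ _ -> ->] := H w; ring.
- apply: (ctrl_lin (a := 1) (b := t) c2 c3) => w.
  by have [_ _ -> ->] := H w; ring.
- by apply: (ctrl_scale (a := -1) c3) => w; have [_ _ _ ->] := H w; ring.
Qed.

(** Control is acquired late in the orbit but has to be used at time 0, where [Qform w] is to be
    bounded by the gain. *)
Lemma ctrl_back0 (U V : nat -> tangent R -> R) :
  (forall j, (j < n)%N -> ctrl (U j.+1) -> ctrl (V j.+1) -> ctrl (U j) /\ ctrl (V j)) ->
  forall j, (j <= n)%N -> ctrl (U j) -> ctrl (V j) -> ctrl (U 0%N) /\ ctrl (V 0%N).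
Proof.
move=> back; elim=> [//|j IH] jn cU cV.
by have [cU' cV'] := back j jn cU cV; apply: IH => //; apply: ltnW.
Qed.

(** Between floor collisions the only possible passage is [Xi1], [Xi2], [Xi3], by balls 23 and then
    balls 12; in [Xi3] both gaps widen, so the floor must come next. In each of these states a floor
    collision adds an independent functional and leads to [XiAll]. *)
Lemma xi_state_step j : (j < n)%N -> xi_state j -> xi_state j.+1.
Proof.
move=> jn [c2 c3|c1 h|c3 h h'|c3 h h'].
- by have [? ?] := XiAll_step jn c2 c3; apply: XiAll.
- have cg := ctrl_gain jn; have /= := step_vel jn; have := orbit_coords j.
  case: (k j) cg => cg H.
  + move=> _.
    (* As s t = 1, [X3] is t times the difference of [X2] and [X2 - s X3]. *)
    have c3 : ctrl (X3 j).
      apply: (ctrl_lin (a := t) (b := - t) cg c1) => w.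
      by rewrite -[X3 j w in LHS]mul1r -st1; ring.
    apply: XiAll.
      by apply: (ctrl_scale (a := 1) cg) => w; have [-> _ _ _] := H w; ring.
    by apply: (ctrl_scale (a := 1) c3) => w; have [_ -> _ _] := H w; ring.
  + by rewrite -/(e2 j) => -[? _ _]; lra.
  + rewrite -/(e2 j) -/(e2 j.+1) -/(e3 j) -/(e3 j.+1) => -[h3 h2' h3'].
    apply: Xi2; rewrite ?h2' ?h3'.
    * apply: (ctrl_lin (a := t) (b := - alpha m (z j) i2 i3) c1 cg) => w.
      have [_ -> _ _] := H w; rewrite mulrBr mulrA [t * s]mulrC st1; ring.
    * by rewrite oppr_lt0.
    (* The new value of s e2 + e3 is s (e2 + t e3) - e3 = s e2. *)
    * rewrite mulrDr mulrA st1 mul1r addrK pmulr_rlt0 //; exact: s_gt0.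
- have cg := ctrl_gain jn; have /= := step_vel jn; have := orbit_coords j.
  case: (k j) cg => cg H.
  + move=> _; apply: XiAll.
      by apply: (ctrl_scale (a := 1) cg) => w; have [-> _ _ _] := H w; ring.
    by apply: (ctrl_scale (a := 1) c3) => w; have [_ -> _ _] := H w; ring.
  + rewrite -/(e2 j) -/(e2 j.+1) -/(e3 j) -/(e3 j.+1) => -[h2 h2' h3'].
    apply: Xi3; rewrite ?h2' ?h3' //.
      by apply: (ctrl_scale (a := 1) c3) => w; have [_ -> _ _] := H w; ring.
    by rewrite oppr_lt0.
  + by rewrite -/(e3 j) => -[? _ _]; lra.
- have cg := ctrl_gain jn; have /= := step_vel jn; have := orbit_coords j.
  case: (k j) cg => cg H.
  + move=> _; apply: XiAll.
      by apply: (ctrl_scale (a := 1) cg) => w; have [-> _ _ _] := H w; ring.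
    by apply: (ctrl_scale (a := 1) c3) => w; have [_ -> _ _] := H w; ring.
  + by rewrite -/(e2 j) => -[? _ _]; lra.
  + by rewrite -/(e3 j) => -[? _ _]; lra.
Qed.

Lemma xi_state_floor j : (j < n)%N -> k j = Floor -> xi_state j ->
  ctrl (X2 j.+1) /\ ctrl (X3 j.+1).
Proof.
move=> jn kj xs; have cg := ctrl_gain jn; have H := orbit_coords j.
rewrite kj in cg H.
suff : ctrl (X3 j) by move=> c3; apply: XiAll_step.
case: xs => // c1 _; apply: (ctrl_lin (a := t) (b := - t) cg c1) => w.
by rewrite -[X3 j w in LHS]mul1r -st1; ring.
Qed.

(* Before the first collision of balls 1 and 2 after a floor collision, the
   line [xi_2 = 0] is preserved. *)
Lemma xi_start_step j : (j < n)%N -> ctrl (X2 j) ->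
  if k j is Balls12 then xi_state j.+1 else ctrl (X2 j.+1).
Proof.
move=> jn c2; have cg := ctrl_gain jn; have /= := step_vel jn; have := orbit_coords j.
case: (k j) cg => cg H.
- by move=> _; apply: (ctrl_scale (a := 1) c2) => w; have [-> _ _ _] := H w; ring.
- rewrite -/(e2 j) -/(e2 j.+1) -/(e3 j) -/(e3 j.+1) => -[h2 h2' h3'].
  apply: Xi1; last by rewrite h2' oppr_lt0.
  apply: (ctrl_lin (a := -1) (b := - alpha m (z j) i1 i2) c2 cg) => w.
  by have [-> -> _ _] := H w; ring.
- by move=> _; apply: (ctrl_scale (a := 1) c2) => w; have [-> _ _ _] := H w; ring.
Qed.

(** Floor collision [i] controls xi_2, collision [j] guarantees that the line xi_2 = 0 has been
    moved, and floor collision [l] then controls a second direction. If another floor collision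
    comes between [j] and [l], the state is [XiAll] already. *)
Lemma ctrl_xi i j l : (i < j)%N -> (j < l)%N -> (l < n)%N ->
  k i = Floor -> k j = Balls12 -> k l = Floor -> ctrl (X2 0%N) /\ ctrl (X3 0%N).
Proof.
move=> ij jl ln ki kj kl.
have st0 d : (i + d < n)%N -> ctrl (X2 (i + d).+1) \/ xi_state (i + d).+1.
  elim: d => [|d IH] idn.
    rewrite addn0 in idn *; left; have := ctrl_gain idn; have := orbit_coords i.
    rewrite ki => H cg; apply: (ctrl_scale (a := 1) cg) => w.
    by have [-> _ _ _] := H w; ring.
  rewrite addnS in idn *.
  case: (IH (ltnW idn)) => [c2|xs]; last by right; apply: xi_state_step.
  by have := xi_start_step idn c2; case: (k _) => h; [left|right|left].
have st1' d : (j + d < n)%N -> xi_state (j + d).+1.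
  elim: d => [|d IH] jdn.
    rewrite addn0 in jdn *.
    have : ctrl (X2 j) \/ xi_state j.
      by have := st0 (j - i.+1)%N; rewrite (_ : (i + _).+1 = j); [apply; lia|lia].
    case=> [c2|xs]; last exact: xi_state_step.
    by have := xi_start_step jdn c2; rewrite kj.
  by rewrite addnS in jdn *; apply: xi_state_step => //; apply: IH; apply: ltnW.
have xl : xi_state l.
  by have := st1' (l - j.+1)%N; rewrite (_ : (j + _).+1 = l); [apply; lia|lia].
have [c2 c3] := xi_state_floor ln kl xl.
exact: (ctrl_back0 (U := X2) (V := X3) XiAll_back ln c2 c3).
Qed.

(** The control of eta_2 gained at [j] survives floor collisions and further collisions of balls 1
    and 2; the first collision of balls 2 and 3 adds eta_3. It may precede [r], whence the
    disjunction in [st]. *)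
Lemma ctrl_eta j r : (j < r)%N -> (r < n)%N ->
  k j = Balls12 -> k r = Balls23 -> ctrl (Y2 0%N) /\ ctrl (Y3 0%N).
Proof.
move=> jr rn kj kr.
have st d : (j + d < n)%N -> ctrl (Y2 (j + d).+1) \/
    ctrl (Y2 0%N) /\ ctrl (Y3 0%N).
  elim: d => [|d IH] jdn.
    rewrite addn0 in jdn *; left; have := ctrl_gain jdn; have := orbit_coords j.
    rewrite kj => H cg; apply: (ctrl_scale (a := -1) cg) => w.
    by have [_ _ -> _] := H w; ring.
  rewrite addnS in jdn *; case: (IH (ltnW jdn)) => [c2|]; last by right.
  have := ctrl_gain jdn; have := orbit_coords (j + d).+1.
  case: (k _) => H cg.
  - left; apply: (ctrl_lin (a := 1) (b := beta m (z (j + d).+1)) c2 cg) => w.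
    by have [_ _ -> _] := H w; ring.
  - left; apply: (ctrl_scale (a := -1) c2) => w.
    by have [_ _ -> _] := H w; ring.
  - right; exact: (ctrl_back0 (U := Y2) (V := Y3) eta_back (ltnW jdn) c2 cg).
have : ctrl (Y2 r) \/ ctrl (Y2 0%N) /\ ctrl (Y3 0%N).
  by have := st (r - j.+1)%N; rewrite (_ : (j + _).+1 = r); [apply; lia|lia].
case=> // c2; have := ctrl_gain rn; rewrite kr => c3.
exact: (ctrl_back0 (U := Y2) (V := Y3) eta_back (ltnW rn) c2 c3).
Qed.

(** Since Q is dominated by the squares of the four coordinates, Q(w) <= C (Q(Dw) - Q(w)). The
    quotient is thus at least 1 + 1/C uniformly in w, so the infimum stays above 1. *)
Lemma sigma_gt1_of_ctrl : ctrl (X2 0%N) -> ctrl (X3 0%N) -> ctrl (Y2 0%N) ->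
  ctrl (Y3 0%N) -> 1 < sigma (D n).
Proof.
move=> [C1 C10 h1] [C2 C20 h2] [C3 C30 h3] [C4 C40 h4].
pose C := C1 + C2 + C3 + C4 + 1.
have C_gt0 : 0 < C by rewrite /C; lra.
have QN w : L1L2 w -> Qform w <= C * N n w.
  move=> [w1 w2]; rewrite /Qform sum_i3 w1 mul0r add0r.
  have N0 : 0 <= N n w by have := gain_le_total w (leq0n n) (leqnn n); rewrite {1}/N subrr.
  have := h1 w; have := h2 w; have := h3 w; have := h4 w.
  rewrite /X2 /X3 /Y2 /Y3 /D /=.
  have := sqr_ge0 (w.1 ord0 i2 - w.2 ord0 i2).
  have := sqr_ge0 (w.1 ord0 i3 - w.2 ord0 i3).
  have := sqr_ge0 (w.1 ord0 i2 + w.2 ord0 i2).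
  have := sqr_ge0 (w.1 ord0 i3 + w.2 ord0 i3).
  rewrite !sqrrB !sqrrD /C !mulrDl mul1r; lra.
have b1 : 1 < Num.sqrt (1 + C^-1).
  rewrite -[X in X < _]sqrtr1 ltr_sqrt; last by rewrite addr_gt0 ?invr_gt0.
  by rewrite ltrDl invr_gt0.
apply: (lt_le_trans b1); apply: lb_le_inf.
  (* The set under the infimum must be shown nonempty; [w0] has Q = 1. *)
  pose w0 : tangent R := (row3 0 1 0, row3 0 1 0).
  exists (Num.sqrt (Qform (D n w0) / Qform w0)), w0 => //; split.
    left; split; first by split; rewrite /= row3E.
    by rewrite /Qform sum_i3 /= !row3E mulr0 mulr1 add0r addr0.
  move=> /= [/(congr1 (fun v : 'rV_3 => v ord0 i2))].
  by rewrite row3E mxE => /eqP; rewrite oner_eq0.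
move=> _ [w [[[wL Qw]|->]] w0 <-]; last by case: w0.
rewrite ler_sqrt; last first.
  by rewrite divr_ge0 // ?ltW //; have := QN w wL; have := gain_le_total w (leq0n n) (leqnn n);
    rewrite /N {1}/D /=; lra.
rewrite ler_pdivlMr // mulrDl mul1r.
have := QN w wL; rewrite -ler_pdivrMl // /N; lra.
Qed.

End Orbit.

Lemma sigma_gt1 (y z : nat -> state R) (k : nat -> collision) (i j l r n : nat) :
  (forall j, (j < n)%N -> poincare_step m c (y j) (z j) (k j) (y j.+1)) ->
  (i < j)%N -> (j < l)%N -> (l < n)%N -> (j < r)%N -> (r < n)%N ->
  k i = Floor -> k j = Balls12 -> k l = Floor -> k r = Balls23 ->
  1 < sigma (dorbit m z k n).
Proof.
move=> st ij jl ln jr rn ki kj kl kr.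
have [c2 c3] := ctrl_xi st ij jl ln ki kj kl.
have [d2 d3] := ctrl_eta st jr rn kj kr.
exact: (sigma_gt1_of_ctrl st).
Qed.

End Expansion.

(** * Infinite branches *)

Lemma nondecreasing_tail_small (R : realType) (f : nat -> R) (N : nat) (B : R) :
  (forall n, (N <= n)%N -> f n <= f n.+1) -> (forall n, (N <= n)%N -> f n <= B) ->
  forall e, 0 < e -> exists2 n0, (N <= n0)%N &
    forall n p, (n0 <= n)%N -> (n <= p)%N -> f p - f n <= e.
Proof.
move=> fS fB e e0.
have mono n p : (N <= n)%N -> (n <= p)%N -> f n <= f p.
  move=> Nn; elim: p => [|p IH]; first by rewrite leqn0 => /eqP ->.
  rewrite leq_eqVlt => /orP[/eqP -> //|np]; apply: le_trans (IH np) (fS _ _).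
  exact: leq_trans Nn np.
pose S := [set f n | n in [set n | (N <= n)%N]].
have hS : has_sup S.
  split; first by exists (f N), N => //=.
  by exists B => _ [n Nn <-]; apply: fB.
have [_ [n0 Nn0 <-] h] := sup_adherent e0 hS.
exists n0 => // n p n0n np.
have h1 := mono _ _ Nn0 n0n.
have Nn := leq_trans Nn0 n0n.
have h2 : f p <= sup S by apply: ub_le_sup; [exact: hS.2|exists p => //=; exact: leq_trans Nn np].
lra.
Qed.

Section InfiniteBranch.
Context (R : realType) (m : 'I_3 -> R) (c : R).
Context (m_gt0 : forall i, 0 < m i) (hm12 : m i2 < m i1) (hm23 : m i3 < m i2).
Implicit Types (x y z : state R) (k : collision).

Let s : R := 1 + gamma m i1 i2.
Let t : R := 1 - gamma m i2 i3.
Context (st1 : s * t = 1).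

Lemma energy_level_collision k x :
  energy_level m c x -> energy_level m c (collision_map m k x).
Proof. by move=> [h hq]; split=> //; rewrite hamiltonian_collision. Qed.

Lemma poincare_step_energy x z k y : poincare_step m c x z k y ->
  [/\ energy_level m c x, energy_level m c z & energy_level m c y].
Proof.
move=> [[T [T0 zE [k' _ [hz _]] hs]] _ ->]; split=> //; last first.
  exact: energy_level_collision.
(* At hitting time 0 the condition on the flight is void, but then [x] is the pre-collision state
   itself; otherwise the condition is used at time 0. *)
move: T0; rewrite le_eqVlt => /orP[/eqP T0|T0].
  suff -> : x = z by [].
  by rewrite zE -T0 -[in RHS](free_flowK m_gt0 0 x) oppr0 (_ : free_flow m 0 x = x) //;
     apply: state_ext => i; rewrite ?pos_free_flow ?mom_free_flow; lra.
have [|h _] := hs 0; first by rewrite lexx.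
by move: h; rewrite (_ : free_flow m 0 x = x) //;
     apply: state_ext => i; rewrite ?pos_free_flow ?mom_free_flow; lra.
Qed.

(** Heights are nonnegative, so 2 c / m_i bounds v_i^2; the summand 1 makes the bound at least 1, so
    that it bounds |v_i| as well, without a square root. *)
Definition speed_bound : R := 1 + (2 * c / m i1 + 2 * c / m i2 + 2 * c / m i3).

Lemma energy_level_speed x i : energy_level m c x -> `|vel m x i| <= speed_bound.
Proof.
move=> [hH [q1 q2 q3]].
have [p1 p2 p3] : [/\ 0 < m i1, 0 < m i2 & 0 < m i3] by split; apply: m_gt0.
have K0 j : 0 <= m j * vel m x j ^+ 2.
  by rewrite mulr_ge0 ?sqr_ge0 // ltW.
have [r1 r2 r3] : [/\ 0 <= m i1 * pos x i1, 0 <= m i2 * pos x i2 & 0 <= m i3 * pos x i3].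
  by split; (apply: mulr_ge0; [exact: ltW|lra]).
have hK j : m j * vel m x j ^+ 2 <= 2 * c.
  rewrite (hamiltonian_velE m_gt0) in hH.
  have k1 := K0 i1; have k2 := K0 i2; have k3 := K0 i3.
  by move: j; apply: all_i3; lra.
have hv j : vel m x j ^+ 2 <= 2 * c / m j.
  by rewrite ler_pdivlMr // mulrC.
have h0 j : 0 <= 2 * c / m j by apply: le_trans (sqr_ge0 _) (hv j).
have g1 : 1 <= speed_bound.
  by rewrite /speed_bound; have := h0 i1; have := h0 i2; have := h0 i3; lra.
have h : vel m x i ^+ 2 <= speed_bound ^+ 2.
  apply: (@le_trans _ _ speed_bound); last by rewrite expr2 ler_peMl //; lra.
  apply: le_trans (hv i) _; rewrite /speed_bound.
  have := h0 i1; have := h0 i2; have := h0 i3.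
  by move: i; apply: all_i3; lra.
rewrite -(ler_sqr (x := `|vel m x i|)) ?nnegrE //; last by lra.
by rewrite real_normK ?num_real.
Qed.

(* Without collisions of balls 2 and 3, the increment of this combination of
   velocities along a step is the sum of the flight time and of the relative
   speed of the collision. *)
Definition potential x : R :=
  ((m i1 + m i2) * vel m x i2 + m i1 * vel m x i1 + m i2 * vel m x i2) / (2 * m i1)
  - (1 + (m i1 + m i2) / m i1) * vel m x i3.

Definition energy12 x : R :=
  m i1 * (vel m x i1 ^+ 2 / 2 + pos x i1) + m i2 * (vel m x i2 ^+ 2 / 2 + pos x i2).

Definition energy1 x : R := vel m x i1 ^+ 2 / 2 + pos x i1.

(** A collision of balls 1 and 2 keeps m_1 v_1 + m_2 v_2 and raises v_2 by 2 m_1 / (m_1 + m_2) times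
    the relative speed; the floor raises m_1 v_1 by 2 m_1 |v_1|. Ball 3 is in free fall, and the
    coefficient of v_3 in [potential] is such that flight increases it at rate 1. *)
Lemma potential_step x z k y : poincare_step m c x z k y -> k <> Balls23 ->
  let e := potential y - potential x in
  [/\ 0 <= e, `|vel m y i1 - vel m x i1| <= 2 * e,
      `|pos y i1 - pos x i1| <= speed_bound * e,
      energy12 y = energy12 x &
      match k with
      | Floor => [/\ pos y i1 = 0, 0 < vel m y i1, vel m y i1 <= e &
                   energy1 y = energy1 x]
      | Balls12 => [/\ pos y i2 = pos y i1, 0 < vel m y i2 - vel m y i1 &
                   vel m y i2 - vel m y i1 <= e]
      | Balls23 => True
      end].
Proof.
move=> st; have [hx hz hy] := poincare_step_energy st.
case: st => -[T [T0 zE _ _]] [_ hk] yE kn e.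
have [n1 n12] := (m_neq0 m_gt0 i1, mD_neq0 m_gt0 i1 i2).
have vx1 := energy_level_speed i1 hx; have vz1 := energy_level_speed i1 hz.
move: vx1 vz1; rewrite zE vel_free_flow // => vx1 vz1.
have posT : T <= e -> `|pos y i1 - pos x i1| <= speed_bound * e.
  move=> Te; rewrite yE pos_collision zE pos_free_flow.
  have -> : pos x i1 + T * vel m x i1 - T ^+ 2 / 2 - pos x i1 =
    T * ((vel m x i1 + (vel m x i1 - T)) / 2) by field.
  rewrite normrM (ger0_norm T0) mulrC ler_pM // normrM.
  rewrite (ger0_norm (x := 2^-1)) ?invr_ge0 //.
  have := ler_normD (vel m x i1) (vel m x i1 - T); lra.
have v_1 := vel_floor m_gt0 z; have v_2 := vel_balls12 m_gt0 z.
have e12 : energy12 z = energy12 x.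
  by rewrite /energy12 zE !vel_free_flow // !pos_free_flow; field.
case: k hk yE kn => [] [hq hv] yE // _.
- move: v_1; rewrite -yE /= => -[v1 v2 v3].
  have eE : e = T - vel m z i1.
    rewrite /e /potential v1 v2 v3 zE !vel_free_flow //; field; exact: n1.
  have Te : T <= e by rewrite eE; lra.
  split; [lra| | exact: posT | |].
  + rewrite v1 eE zE !vel_free_flow //.
    have hv' : vel m x i1 - T < 0 by rewrite -(vel_free_flow m_gt0) -zE.
    by rewrite ler_norml; apply/andP; split; lra.
  + by rewrite -e12 /energy12 v1 v2 yE !pos_collision sqrrN.
  + split; [by rewrite yE pos_collision|rewrite v1; lra|rewrite v1; lra|].
    by rewrite /energy1 v1 yE pos_collision zE vel_free_flow // pos_free_flow; field.
- move: v_2; rewrite -yE /= => -[v1 v2 v3].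
  have eE : e = T + (vel m z i1 - vel m z i2).
    rewrite /e /potential v1 v2 v3 zE !vel_free_flow // /gamma; field.
    by rewrite n1 n12.
  have Te : T <= e by rewrite eE; lra.
  have g01 : 0 < 1 - gamma m i1 i2 < 1.
    have p1 := m_gt0 i1; have p2 := m_gt0 i2; have p12 := addr_gt0 p1 p2.
    rewrite /gamma (_ : 1 - _ = 2 * m i2 / (m i1 + m i2)); last by field.
    rewrite divr_gt0 ?mulr_gt0 // ltr_pdivrMr // mul1r /=; move: hm12; lra.
  have dvE : vel m y i2 - vel m y i1 = vel m z i1 - vel m z i2.
    by rewrite v1 v2; ring.
  split; [lra| | exact: posT | |].
  + have -> : vel m y i1 - vel m x i1 =
      - T - (1 - gamma m i1 i2) * (vel m z i1 - vel m z i2).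
      by rewrite v1 zE !vel_free_flow //; ring.
    have r0 : 0 < vel m z i1 - vel m z i2 by lra.
    have : (1 - gamma m i1 i2) * (vel m z i1 - vel m z i2) <=
           vel m z i1 - vel m z i2 by rewrite ler_piMl //; lra.
    have : 0 <= (1 - gamma m i1 i2) * (vel m z i1 - vel m z i2).
      by rewrite mulr_ge0 //; lra.
    by move=> ? ?; rewrite ler_norml; apply/andP; split; lra.
  + rewrite -e12 /energy12 v1 v2 yE !pos_collision.
    by rewrite /gamma; field.
  + split; [by rewrite yE !pos_collision|rewrite dvE; lra|rewrite dvE; lra].
Qed.

Section Branch.
Context (y z : nat -> state R) (k : nat -> collision).
Context (st : forall j, poincare_step m c (y j) (z j) (k j) (y j.+1)).

Let e2 j := vel m (y j) i1 - vel m (y j) i2.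
Let e3 j := vel m (y j) i2 - vel m (y j) i3.

Let step_vel j := poincare_step_vel m_gt0 (st j).

(** Without the floor, the relative velocities evolve by the two reflections alone. From a collision
    of balls 12 on, the collisions must alternate, and after 12, 23, 12 both relative velocities are
    negative, so nothing can follow. At most one collision of balls 23 precedes the first one of
    balls 12. *)
Lemma floor_infinitely_often n : exists2 p, (n <= p)%N & k p = Floor.
Proof.
apply: contrapT => noF.
have nF p : (n <= p)%N -> k p <> Floor by move=> np kp; apply: noF; exists p.
have s0 := s_gt0 m_gt0; rewrite -/s in s0.
have neg j : (n <= j)%N -> e2 j < 0 -> e3 j < 0 -> False.
  move=> nj h2 h3; have /= := step_vel j; have := nF _ nj.
  case: (k j) => // _; rewrite -/(e2 j) -/(e3 j); [case=> ? _ _; lra|case=> ? _ _; lra].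
have S2 j : (n <= j)%N -> e3 j < 0 -> s * e2 j + e3 j < 0 -> False.
  move=> nj h3 h23; have /= := step_vel j; have := nF _ nj.
  case E : (k j) => // _; rewrite -/(e2 j) -/(e3 j) -/(e2 j.+1) -/(e3 j.+1).
    move=> [p2 h2' h3']; apply: (neg j.+1); rewrite ?h2' ?h3' -/s; [lia|lra|lra].
  by move=> [? _ _]; lra.
have S1 j : (n <= j)%N -> e2 j < 0 -> False.
  move=> nj h2; have /= := step_vel j; have := nF _ nj.
  case E : (k j) => // _; rewrite -/(e2 j) -/(e3 j) -/(e2 j.+1) -/(e3 j.+1).
    by move=> [? _ _]; lra.
  move=> [p3 h2' h3']; apply: (S2 j.+1); rewrite ?h2' ?h3' -/t; [lia|lra|].
  by rewrite mulrDr mulrA st1 mul1r addrK pmulr_rlt0.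
have S0 j : (n <= j)%N -> k j = Balls12 -> False.
  move=> nj kj; have /= := step_vel j; rewrite kj -/(e2 j) -/(e2 j.+1).
  by move=> [p2 h2' _]; apply: (S1 j.+1); rewrite ?h2'; [lia|lra].
have := S0 n (leqnn n); have := S0 n.+1 (leqnSn n).
have := nF n (leqnn n); have := nF n.+1 (leqnSn n).
have /= := step_vel n; have /= := step_vel n.+1.
case: (k n) => //; case: (k n.+1) => // + + _ _ _ _.
rewrite -/(e3 n) -/(e3 n.+1) => -[h _ _] [h' _ h'']; lra.
Qed.

(* Otherwise the increments of the potential are summable, so balls 1 and 2
   come to rest on the floor, whereas their energy is constant and positive. *)
Lemma balls23_infinitely_often N : exists2 p, (N <= p)%N & k p = Balls23.
Proof.
apply: contrapT => no2.
have n2 p : (N <= p)%N -> k p <> Balls23 by move=> Np kp; apply: no2; exists p.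
pose f n := potential (y n).
have step n (Nn : (N <= n)%N) := potential_step (st n) (n2 n Nn).
have fS n : (N <= n)%N -> f n <= f n.+1.
  by move=> /step /= [h _ _ _ _]; rewrite -subr_ge0.
have [p1 p2] : 0 < m i1 /\ 0 < m i2 by split; apply: m_gt0.
have enY n : energy_level m c (y n) by case: (poincare_step_energy (st n)).
have V0 : 0 <= speed_bound by apply: le_trans (normr_ge0 _) (energy_level_speed i1 (enY 0%N)).
pose B := ((m i1 + m i2) * speed_bound + m i1 * speed_bound + m i2 * speed_bound)
   / (2 * m i1) + (1 + (m i1 + m i2) / m i1) * speed_bound.
have fB n : (N <= n)%N -> f n <= B.
  move=> _; rewrite /f /potential /B.
  have bv i : vel m (y n) i <= speed_bound by apply: le_trans (ler_norm _) (energy_level_speed i (enY n)).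
  have bv' : - vel m (y n) i3 <= speed_bound.
    by apply: le_trans (ler_norm _) _; rewrite normrN; apply: energy_level_speed.
  apply: lerD.
    by rewrite ler_pM2r ?invr_gt0 ?mulr_gt0 // !lerD // ler_wpM2l // ?addr_ge0 ?ltW.
  rewrite -mulrN ler_wpM2l // addr_ge0 // divr_ge0 ?addr_ge0 ?ltW //.
have small := nondecreasing_tail_small fS fB.
(* After a late floor collision ball 1 has height 0 and velocity at most [e]; its velocity varies by
   at most [2 * e] afterwards, which gives [3 * e]. *)
have near_rest e : 0 < e -> exists n1, [/\ (N <= n1)%N, k n1 = Floor &
    forall p, (n1 < p)%N -> [/\ `|vel m (y p) i1| <= 3 * e,
      pos (y p) i1 <= speed_bound * e & f p.+1 - f p <= e]].
  move=> /small[n0 Nn0 hn0]; have [n1 n01 kn1] := floor_infinitely_often n0.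
  exists n1; split=> // [|p n1p]; first exact: leq_trans Nn0 n01.
  have Nn1 := leq_trans Nn0 n01.
  have hv p' : (n1.+1 <= p')%N ->
     `|vel m (y p') i1 - vel m (y n1.+1) i1| <= 2 * (f p' - f n1.+1) /\
     `|pos (y p') i1 - pos (y n1.+1) i1| <= speed_bound * (f p' - f n1.+1).
    elim: p' => // p' IH; rewrite leq_eqVlt => /orP[/eqP <-|np].
      by rewrite !subrr !normr0 !mulr0.
    have [a1 a2] := IH np.
    have [_ b1 b2 _ _] := step p' (leq_trans Nn1 (ltnW np)).
    rewrite -/(f p') -/(f p'.+1) in b1 b2; split.
      rewrite -(subrK (vel m (y p') i1) (vel m (y p'.+1) i1)) -addrA.
      by apply: le_trans (ler_normD _ _) _; lra.
    rewrite -(subrK (pos (y p') i1) (pos (y p'.+1) i1)) -addrA.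
    apply: le_trans (ler_normD _ _) _.
    have -> : speed_bound * (f p'.+1 - f n1.+1) = speed_bound * (f p'.+1 - f p') +
       speed_bound * (f p' - f n1.+1) by ring.
    exact: lerD.
  have [_ _ _ _] := step n1 Nn1; rewrite kn1 -/(f n1) -/(f n1.+1) => -[q0 v0 v1 _].
  have e1 := hn0 n1 n1.+1 n01 (leqnSn _).
  have e2' := hn0 n1.+1 p (leqW n01) n1p.
  have [h1 h2] := hv p n1p; split; last by apply: hn0 => //; lia.
    rewrite -(subrK (vel m (y n1.+1) i1) (vel m (y p) i1)).
    apply: le_trans (ler_normD _ _) _; rewrite (gtr0_norm v0); lra.
  rewrite q0 subr0 in h2.
  apply: le_trans (ler_norm _) (le_trans h2 _).
  by rewrite ler_wpM2l.
have E12c n : (N <= n)%N -> energy12 (y n) = energy12 (y N).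
  elim: n => [|n IH]; first by rewrite leqn0 => /eqP ->.
  rewrite leq_eqVlt => /orP[/eqP -> //|Nn].
  by have [_ _ _ -> _] := step n Nn; apply: IH.
have q0 n : 0 <= pos (y n) i1 /\ 0 <= pos (y n) i2.
  by have [_ [h1 h2 h3]] := enY n; split=> //; apply: le_trans h1 h2.
(* If balls 1 and 2 also stop colliding, the energy of ball 1 alone is conserved. Otherwise a late
   collision between them brings ball 2 close to rest as well, and their joint energy is used. *)
have [[M NM noM1]|inf1] := pselect (exists2 M, (N <= M)%N & forall p, (M <= p)%N -> k p <> Balls12).
  have E1c n : (M <= n)%N -> energy1 (y n) = energy1 (y M).
    elim: n => [|n IH]; first by rewrite leqn0 => /eqP ->.
    rewrite leq_eqVlt => /orP[/eqP -> //|Nn].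
    have Nn' := leq_trans NM Nn.
    have [_ _ _ _] := step n Nn'; have := noM1 n Nn; have := n2 n Nn'.
    by case: (k n) => // _ _ [_ _ _ ->]; apply: IH.
  have E0 : 0 < energy1 (y M).
    have [n Mn kn] := floor_infinitely_often M.
    have [_ _ _ _] := step n (leq_trans NM Mn); rewrite kn => -[_ v0 _ _].
    rewrite -(E1c n.+1 (leqW Mn)) /energy1.
    by apply: ltr_wpDr; rewrite ?(q0 _).1 // divr_gt0 // exprn_gt0.
  (* Near rest v_1^2 / 2 + q_1 is at most (3 e)^2 / 2 + [speed_bound] e, which for e <= 1 is less
     than e (9 + [speed_bound]). *)
  pose e := Num.min 1 (energy1 (y M) / (9 + speed_bound)).
  have V9 : 0 < 9 + speed_bound by lra.
  have e0 : 0 < e by rewrite lt_min ltr01 divr_gt0.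
  have e1 : e <= 1 by rewrite ge_min lexx.
  have eE : e * (9 + speed_bound) <= energy1 (y M).
    by rewrite -ler_pdivlMr // ge_min lexx orbT.
  have [n1 [_ _ /(_ (maxn M n1.+1))]] := near_rest e e0.
  move=> [|h1 h2 _]; first by rewrite leq_max ltnSn orbT.
  move: eE; rewrite -(E1c (maxn M n1.+1)) ?leq_maxl //.
  rewrite /energy1 -(real_normK (num_real (vel m (y _) i1))) expr2.
  have : `|vel m (y (maxn M n1.+1)) i1| * `|vel m (y (maxn M n1.+1)) i1| <= (3 * e) * (3 * e).
    by apply: ler_pM.
  have : e * e <= e by rewrite ger_pMl.
  lra.
have E0 : 0 < energy12 (y N).
  have [n Mn kn] := floor_infinitely_often N.
  have [_ _ _ _] := step n Mn; rewrite kn => -[_ v0 _ _].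
  rewrite -(E12c n.+1 (leqW Mn)) /energy12; have [a1 a2] := q0 n.+1.
  apply: ltr_wpDr.
    by rewrite mulr_ge0 ?addr_ge0 ?divr_ge0 ?sqr_ge0 // ltW.
  by rewrite mulr_gt0 //; apply: ltr_wpDr => //; rewrite divr_gt0 // exprn_gt0.
(* After a late collision of balls 1 and 2 the heights agree and |v_2| <= 3 e + e, so each v_i^2 / 2
   + q_i is at most (8 + [speed_bound]) e. *)
pose C := (m i1 + m i2) * (9 + speed_bound).
have V9 : 0 < 9 + speed_bound by lra.
have C0 : 0 < C by rewrite mulr_gt0 // addr_gt0.
pose e := Num.min 1 (energy12 (y N) / C / 2).
have e0 : 0 < e by rewrite lt_min ltr01 !divr_gt0.
have e1 : e <= 1 by rewrite ge_min lexx.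
have eE : e * C <= energy12 (y N) / 2.
  by rewrite -ler_pdivlMr // ge_min mulrAC lexx orbT.
have [n1 [Nn1 _ rest]] := near_rest e e0.
have [p n1p kp] : exists2 p, (n1 < p)%N & k p = Balls12.
  apply: contrapT => no1; apply: inf1; exists n1.+1; first exact: leqW.
  by move=> p n1p kp; apply: no1; exists p.
have [_ _ h3] := rest p n1p; have [h1 h2 _] := rest p.+1 (leqW n1p).
have [_ _ _ _] := step p (leq_trans Nn1 (ltnW n1p)).
rewrite kp -/(f p) -/(f p.+1) => -[q12 v0 v1].
have := E12c p.+1 (leqW (leq_trans Nn1 (ltnW n1p))).
rewrite /energy12 q12.
have ee : e * e <= e by rewrite ger_pMl.
have sq (v : R) : `|v| <= 4 * e -> v ^+ 2 / 2 <= 8 * e.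
  move=> hv; have : v ^+ 2 <= (4 * e) ^+ 2.
    by rewrite -(real_normK (num_real v)) ler_sqr ?nnegrE //; lra.
  rewrite exprMn [e ^+ 2]expr2; lra.
have w1 : vel m (y p.+1) i1 ^+ 2 / 2 <= 8 * e by apply: sq; lra.
have w2 : vel m (y p.+1) i2 ^+ 2 / 2 <= 8 * e.
  by apply: sq; move: h1; rewrite !ler_norml => /andP[? ?]; apply/andP; split; lra.
set a := vel m (y p.+1) i1 ^+ 2 / 2 in w1 *; set b := vel m _ i2 ^+ 2 / 2 in w2 *.
have b1 : m i1 * (a + pos (y p.+1) i1) <= m i1 * ((9 + speed_bound) * e).
  by rewrite ler_pM2l //; lra.
have b2 : m i2 * (b + pos (y p.+1) i1) <= m i2 * ((9 + speed_bound) * e).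
  by rewrite ler_pM2l //; lra.
move=> hE; rewrite /energy12 in eE E0; rewrite -hE in eE E0; move: eE; rewrite /C.
have -> : e * ((m i1 + m i2) * (9 + speed_bound)) =
  m i1 * ((9 + speed_bound) * e) + m i2 * ((9 + speed_bound) * e) by ring.
lra.
Qed.

(** A collision of balls 2 and 3 makes [e3] negative and the floor leaves it unchanged, so they
    cannot meet again before ball 1 hits ball 2. *)
Lemma balls12_infinitely_often N : exists2 p, (N <= p)%N & k p = Balls12.
Proof.
apply: contrapT => no1.
have n1 p : (N <= p)%N -> k p <> Balls12 by move=> Np kp; apply: no1; exists p.
have [p Np kp] := balls23_infinitely_often N.
have neg d : e3 (p.+1 + d) < 0.
  elim: d => [|d IH].
    have /= := step_vel p; rewrite kp addn0 -/(e3 p) -/(e3 p.+1) => -[? _ ->]; lra.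
  have /= := step_vel (p.+1 + d); rewrite addnS.
  have := n1 (p.+1 + d)%N; rewrite -/(e3 (p.+1 + d)) -/(e3 (p.+1 + d).+1).
  case: (k _) => [_ ->|h|_ [? _ _]] //; [by case: h => //; lia|lra].
have [r pr kr] := balls23_infinitely_often p.+1.
have := neg (r - p.+1)%N; rewrite subnKC // => h.
have /= := step_vel r; rewrite kr -/(e3 r) => -[h' _ _].
by have := lt_trans h h'; rewrite ltxx.
Qed.

Lemma infinite_branch_expanding :
  exists2 n, (1 <= n)%N & 1 < sigma (dorbit m z k n).
Proof.
have [i _ ki] := floor_infinitely_often 0.
have [j ij kj] := balls12_infinitely_often i.+1.
have [l jl kl] := floor_infinitely_often j.+1.
have [r lr kr] := balls23_infinitely_often l.+1.
exists r.+1 => //.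
by apply: (sigma_gt1 m_gt0 hm12 hm23 st1 (i := i) (j := j) (l := l) (r := r)
   (y := y)) => //; lia.
Qed.

End Branch.
End InfiniteBranch.

(** * Branches that stop *)

Section BadPoints.
Context (R : realType) (m : 'I_3 -> R) (c : R).
Context (m_gt0 : forall i, 0 < m i).
Implicit Types (x y z : state R) (k : collision).

(** The face without its grazing points. Strictness allows the flight time to be recovered from the
    state at the end of the flight, and every image under T has it. *)
Definition strictly_after k x : Prop := match k with
  | Floor => pos x i1 = 0 /\ 0 < vel m x i1
  | Balls12 => pos x i1 = pos x i2 /\ vel m x i1 < vel m x i2
  | Balls23 => pos x i2 = pos x i3 /\ vel m x i2 < vel m x i3
  end.

(* Contains every state without image that is not grazing on its face. *)
Definition dead x : Prop :=
  [/\ hamiltonian m x = c, pos x i1 = 0, mom x i1 = 0 &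
      pos x i1 = pos x i2 \/ pos x i2 = pos x i3].

(** Some branch reaches [dead] after n steps; strictness is recorded at each stage so that the steps
    can be inverted. Such a point may still be least expanding, if the gain suffices before the
    stop. *)
Fixpoint bad (n : nat) x : Prop := if n is n'.+1 then
    exists k0, strictly_after k0 x /\
    exists z k y, poincare_step m c x z k y /\ bad n' y
  else dead x.

Lemma poincare_step_strictly_after x z k y :
  poincare_step m c x z k y -> strictly_after k y.
Proof.
case=> _ [_ hk] ->; case: k hk => -[hq hv] /=.
- by have [-> _ _] := vel_floor m_gt0 z; split; [|rewrite oppr_gt0].
- by have [-> -> _] := vel_balls12 m_gt0 z; split; [|lra].
- by have [_ -> ->] := vel_balls23 m_gt0 z; split; [|lra].
Qed.

(* The time elapsed since a state [x] of the face [k], read off the state [z]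
   reached by free flight; at the floor, v_1(x)^2 = v_1(z)^2 + 2 q_1(z). *)
Definition back_time k z : R := match k with
  | Floor => Num.sqrt (vel m z i1 ^+ 2 + 2 * pos z i1) - vel m z i1
  | Balls12 => (pos z i2 - pos z i1) / (vel m z i2 - vel m z i1)
  | Balls23 => (pos z i3 - pos z i2) / (vel m z i3 - vel m z i2)
  end.

Definition back_dom k z : Prop := match k with
  | Floor => 0 < vel m z i1 ^+ 2 + 2 * pos z i1
  | Balls12 => vel m z i2 - vel m z i1 != 0
  | Balls23 => vel m z i3 - vel m z i2 != 0
  end.

Lemma back_timeE k t x : strictly_after k x ->
  back_dom k (free_flow m t x) /\ back_time k (free_flow m t x) = t.
Proof.
case: k => -[hq hv] /=; rewrite !vel_free_flow // !pos_free_flow.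
- rewrite hq (_ : _ + 2 * _ = vel m x i1 ^+ 2); last by field.
  by rewrite sqrtr_sqr gtr0_norm // exprn_gt0 //; split=> //; ring.
- have v0 : vel m x i2 - vel m x i1 != 0 by rewrite subr_eq0 gt_eqF.
  rewrite -hq (_ : _ - t - (_ - t) = vel m x i2 - vel m x i1); last by ring.
  by split=> //; apply: (canLR (mulfK v0)); ring.
- have v0 : vel m x i3 - vel m x i2 != 0 by rewrite subr_eq0 gt_eqF.
  rewrite -hq (_ : _ - t - (_ - t) = vel m x i3 - vel m x i2); last by ring.
  by split=> //; apply: (canLR (mulfK v0)); ring.
Qed.

Definition back_step k0 k y : state R :=
  free_flow m (- back_time k0 (collision_map m k y)) (collision_map m k y).

(** The collision is an involution and the flight time is a function of the state before it, so [y]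
    and the two faces determine [x]: T has nine inverse branches, given by explicit formulas. *)
Lemma poincare_step_back k0 x z k y : strictly_after k0 x ->
  poincare_step m c x z k y ->
  back_dom k0 (collision_map m k y) /\ x = back_step k0 k y.
Proof.
move=> sx [[T [T0 zE _ _]] _ yE].
rewrite /back_step yE collision_mapK // zE.
have [h1 h2] := back_timeE T sx; split=> //.
by rewrite h2 free_flowK.
Qed.

Context (hm12 : m i2 < m i1) (hm23 : m i3 < m i2).
Context (st1 : (1 + gamma m i1 i2) * (1 - gamma m i2 i3) = 1).

(** A branch that witnesses the failure cannot be infinite, so it has a first point without image;
    there ball 1 rests on the floor. Descending from it along the branch gives [bad]. *)
Lemma not_least_expanding k0 x : section_plus m c x -> strictly_after k0 x ->
  ~ least_expanding m c x -> exists n, bad n x.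
Proof.
move=> xS sx nLE.
have : ~ forall (y z : nat -> state R) (k : nat -> collision),
      branch m c x y z k ->
      exists n : nat, [/\ (1 <= n)%N,
        forall j : nat, (j < n)%N ->
          poincare_step m c (y j) (z j) (k j) (y j.+1) &
        1 < sigma (dorbit m z k n)] by move=> h; apply: nLE.
move=> /existsNP[y /existsNP[z /existsNP[k /not_implyP[[y0 br] noexp]]]].
pose alive n := exists z' k' y', poincare_step m c (y n) z' k' y'.
have [[n dn]|noend] := pselect (exists n, ~ alive n); last first.
  have st j : poincare_step m c (y j) (z j) (k j) (y j.+1).
    by apply: br; apply: contrapT => ndj; apply: noend; exists j.
  have [n n1 hs] := infinite_branch_expanding m_gt0 hm12 hm23 st1 st.
  by exfalso; apply: noexp; exists n; split.
have [n' [dn' lt_n']] : exists n', ~ alive n' /\ forall j, (j < n')%N -> alive j.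
  have ex : exists n, `[< ~ alive n >] by exists n; apply/asboolP.
  exists (ex_minn ex); case: ex_minnP => p /asboolP dp minp; split=> // j jp.
  by apply: contrapT => naj; have := minp j; rewrite leqNgt jp => /(_ (asboolT naj)).
have st j : (j < n')%N -> poincare_step m c (y j) (z j) (k j) (y j.+1).
  by move=> jn; apply: br; apply: lt_n'.
have strict j : (j <= n')%N -> exists k', strictly_after k' (y j).
  case: j => [|j] jn; first by exists k0; rewrite y0.
  by exists (k j); apply: poincare_step_strictly_after (st j jn).
have en : energy_level m c (y n').
  case: n' st {dn' lt_n' strict} => [|p] st.
    by rewrite y0; case: xS => ? _ [].
  by have [] := poincare_step_energy m_gt0 (st p (ltnSn p)).
have dead_n : dead (y n').
  have [q1 v1] : pos (y n') i1 = 0 /\ vel m (y n') i1 = 0.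
    by apply: contrapT => h; apply: dn'; apply: poincare_step_exists.
  split; [by case: en|by []|by rewrite (momE m_gt0) v1 mulr0|].
  (* The stopping point lies strictly on some face; v_1 = 0 rules out the floor, which leaves a
     second coincidence of positions and so lowers the dimension to 2. *)
  have [k' sk'] := strict n' (leqnn n').
  case: k' sk' => -[h1 h2]; [by rewrite v1 ltxx in h2|by left|by right].
suff H d : (d <= n')%N -> bad d (y (n' - d)%N).
  by exists n'; have := H n' (leqnn n'); rewrite subnn y0.
elim: d => [|d IH] dn1; first by rewrite subn0.
have [k1 sk1] := strict (n' - d.+1)%N (leq_subr _ _).
exists k1; split=> //.
exists (z (n' - d.+1)%N), (k (n' - d.+1)%N), (y (n' - d)%N); split.
  have := st (n' - d.+1)%N; rewrite (_ : (n' - d.+1).+1 = n' - d)%N; last by lia.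
  by apply; lia.
by apply: IH; apply: ltnW.
Qed.

End BadPoints.

(** The squared condition is 4 m_1 m_3 = (m_1 + m_2)(m_2 + m_3). For m_2 = m_3 it would read (m_1 -
    m_2) m_2 = 0, so m_2 > m_3 and collisions of balls 2 and 3 have a positive gain too. *)
Lemma mass_condition (R : realType) (m : 'I_3 -> R)
    (hm12 : m i2 < m i1) (hm23 : m i3 <= m i2) (hm3 : 0 < m i3)
    (hm : 2 * Num.sqrt (m i1) * Num.sqrt (m i3) =
          Num.sqrt (m i1 + m i2) * Num.sqrt (m i2 + m i3)) :
  [/\ forall i, 0 < m i, m i3 < m i2 &
      (1 + gamma m i1 i2) * (1 - gamma m i2 i3) = 1].
Proof.
have m2 : 0 < m i2 by lra.
have m1 : 0 < m i1 by lra.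
have hm4 : 4 * m i1 * m i3 = (m i1 + m i2) * (m i2 + m i3).
  have := congr1 (fun u => u ^+ 2) hm.
  by rewrite !exprMn !sqr_sqrtr ?addr_ge0 ?ltW // -[2 ^+ 2]natrX.
have mpos : forall i, 0 < m i by apply: all_i3.
split=> //; last first.
  rewrite /gamma (_ : _ * _ = 4 * m i1 * m i3 / ((m i1 + m i2) * (m i2 + m i3))).
    by rewrite hm4 divff // mulf_neq0 // mD_neq0.
  by field; rewrite !mD_neq0.
rewrite lt_neqAle hm23 andbT; apply/eqP => h; move: hm4; rewrite h => hm4.
have : (m i1 - m i2) * m i2 = 0 by lra.
by move=> /eqP; rewrite mulf_eq0 subr_eq0 !gt_eqF.
Qed.

(** * Sets of zero Hausdorff measure *)

Section HausdorffNull.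
Context (R : realType).

(* [A] has s-dimensional Hausdorff measure 0; the radius 0 is allowed, so that
   finite covers can be padded with points. *)
Definition hausdorff_null (V : normedZmodType R) (s : nat) (A : set V) : Prop :=
  forall e : R, 0 < e -> exists (a : nat -> V) (r : nat -> R),
    [/\ forall i, 0 <= r i,
        A `<=` \bigcup_i [set x | `|x - a i| <= r i] &
        forall n, \sum_(i < n) r i ^+ s <= e].

Lemma hausdorff_null_sub (V : normedZmodType R) s (A B : set V) :
  A `<=` B -> hausdorff_null s B -> hausdorff_null s A.
Proof.
move=> AB hB e e0; have [a [r [r0 cov sum]]] := hB e e0.
by exists a, r; split=> //; apply: subset_trans AB cov.
Qed.

(** The double family is enumerated through [pickle]. Numbers that code no pair receive radius 0,
    harmless because 0^s = 0 for s > 0. *)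
Lemma hausdorff_null_double (V : normedZmodType R) s (A : set V) : (0 < s)%N ->
  (forall e : R, 0 < e -> exists (a : nat -> nat -> V) (r : nat -> nat -> R),
    [/\ forall i j, 0 <= r i j,
        A `<=` \bigcup_i \bigcup_j [set x | `|x - a i j| <= r i j] &
        forall n p, \sum_(i < n) \sum_(j < p) r i j ^+ s <= e]) ->
  hausdorff_null s A.
Proof.
move=> s0 hA e e0; have [a [r [r0 cov sum]]] := hA e e0.
pose u k : option (nat * nat) := pickle_inv k.
exists (fun k => if u k is Some p then a p.1 p.2 else 0),
  (fun k => if u k is Some p then r p.1 p.2 else 0); split.
- by move=> k; case: (u k).
- move=> x /cov [i _ [j _ h]]; exists (pickle (i, j)) => //=.
  by rewrite /u pickleK_inv.
move=> n.
pose N := (\max_(k < n) (if u k is Some p then maxn p.1 p.2 else 0)).+1.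
apply: le_trans (sum N N).
(* Each pair has only one code, so after exchanging the sums every ball is counted at most once. *)
pose h k i j : R := if u k == Some (i, j) then r i j ^+ s else 0.
have h0 k i j : 0 <= h k i j by rewrite /h; case: ifP => // _; rewrite exprn_ge0.
apply: (@le_trans _ _ (\sum_(k < n) \sum_(i < N) \sum_(j < N) h k i j)).
  apply: ler_sum => k _; case E : (u k) => [[i j]|]; last first.
    by rewrite expr0n gtn_eqF //= sumr_ge0 // => i _; apply: sumr_ge0 => j _.
  have hN : (maxn i j < N)%N.
    rewrite ltnS; have := leq_bigmax (F := fun k : 'I_n =>
      if u k is Some p then maxn p.1 p.2 else 0%N) k.
    by rewrite E.
  have iN : (i < N)%N by apply: leq_ltn_trans hN; rewrite leq_maxl.
  have jN : (j < N)%N by apply: leq_ltn_trans hN; rewrite leq_maxr.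
  rewrite (bigD1 (Ordinal iN)) //= (bigD1 (Ordinal jN)) //= {1}/h E eqxx.
  by rewrite -addrA lerDl addr_ge0 //; do ?[apply: sumr_ge0 => ? _].
rewrite exchange_big; apply: ler_sum => i _.
rewrite exchange_big; apply: ler_sum => j _ /=.
have hP k : u k = Some (val i, val j) -> pickle (val i, val j) = k.
  by move=> uk; have := @pickle_invK (nat * nat)%type k; rewrite -/(u k) uk.
have [kn|kn] := ltnP (pickle (val i, val j)) n; last first.
  rewrite big1 ?exprn_ge0 // => k _; rewrite /h; case: eqP => // /hP kE.
  by move: kn; rewrite kE leqNgt ltn_ord.
rewrite (bigD1 (Ordinal kn)) //= big1 ?addr0 => [|k kne]; last first.
  rewrite /h; case: eqP => // /hP kE; case/eqP: kne.
  exact: val_inj.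
by rewrite /h; case: ifP => //; rewrite exprn_ge0.
Qed.

Lemma half_series_le (e : R) n : 0 <= e -> \sum_(i < n) e / 2 ^+ i.+1 <= e.
Proof.
move=> e0; suff -> : \sum_(i < n) e / 2 ^+ i.+1 = e - e / 2 ^+ n.
  by rewrite gerBl divr_ge0 // exprn_ge0.
elim: n => [|n IH]; first by rewrite big_ord0 expr0 divr1 subrr.
rewrite big_ord_recr /= IH exprS; field.
by rewrite expf_neq0.
Qed.

Lemma hausdorff_null_bigcup (V : normedZmodType R) s (A : nat -> set V) :
  (0 < s)%N -> (forall n, hausdorff_null s (A n)) ->
  hausdorff_null s (\bigcup_n A n).
Proof.
move=> s0 hA; apply: hausdorff_null_double => // e e0.
have /choice[ar har] : forall n, exists ar : (nat -> V) * (nat -> R),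
    [/\ forall i, 0 <= ar.2 i,
        A n `<=` \bigcup_i [set x | `|x - ar.1 i| <= ar.2 i] &
        forall p, \sum_(i < p) ar.2 i ^+ s <= e / 2 ^+ n.+1].
  move=> n; have [|a [r h]] := hA n (e / 2 ^+ n.+1); last by exists (a, r).
  by rewrite divr_gt0 // exprn_gt0.
exists (fun n => (ar n).1), (fun n => (ar n).2); split.
- by move=> i j; case: (har i).
- move=> x [n _ Anx]; exists n => //.
  by case: (har n) => _ /(_ x Anx).
- move=> n p; apply: le_trans (half_series_le n (ltW e0)).
  by apply: ler_sum => i _; case: (har i).
Qed.

Lemma hausdorff_nullU (V : normedZmodType R) s (A B : set V) : (0 < s)%N ->
  hausdorff_null s A -> hausdorff_null s B -> hausdorff_null s (A `|` B).
Proof.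
move=> s0 hA hB.
apply: (@hausdorff_null_sub _ _ _ (\bigcup_n (if n is 0%N then A else B))).
  by move=> x [Ax|Bx]; [exists 0%N|exists 1%N].
by apply: hausdorff_null_bigcup => // -[|n].
Qed.

(** Each r_i^s is bounded by the whole sum, so a small sum forces small radii; this is why
    [hausdorff_null] prescribes no bound on them. *)
Lemma hausdorff_null_pos (V : normedZmodType R) s (A : set V) : (0 < s)%N ->
  hausdorff_null s A ->
  forall e d : R, 0 < e -> 0 < d -> exists (a : nat -> V) (r : nat -> R),
    [/\ forall i, 0 < r i <= d,
        A `<=` \bigcup_i [set x | `|x - a i| < r i] &
        forall n, \sum_(i < n) r i ^+ s <= e].
Proof.
move=> s0 hA e d e0 d0.
pose f := Num.min (Num.min 1 e) (d ^+ s).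
have d's : 0 < d ^+ s by rewrite exprn_gt0.
have f0 : 0 < f by rewrite !lt_min ltr01 e0.
have [|a [r [r0 cov sum]]] := hA (f / 2 ^+ s / 2).
  by rewrite !divr_gt0 // exprn_gt0.
(* Doubling makes the balls open where r_i > 0, and the geometric term takes over where r_i = 0.
   That term is at most 1, so its s-th power does not exceed it. *)
pose q i : R := Num.max (2 * r i) (f / 2 / 2 ^+ i.+1).
have p0 i : 0 < f / 2 / 2 ^+ i.+1 by rewrite !divr_gt0 // exprn_gt0.
have q0 i : 0 < q i by rewrite lt_max p0 orbT.
have p1 i : f / 2 / 2 ^+ i.+1 <= 1.
  apply: (@le_trans _ _ (1 / 1)); last by rewrite divr1.
  apply: ler_pM => //; rewrite ?invr_ge0 ?exprn_ge0 ?divr_ge0 ?ltW //.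
    by rewrite ltr_pdivrMr // mul1r; apply: (@le_lt_trans _ _ 1); rewrite ?ltr1n // !ge_min lexx.
  by rewrite invr1 invf_lt1 ?exprn_gt0 // exprn_egt1 // ltr1n.
have qs i : q i ^+ s <= 2 ^+ s * r i ^+ s + f / 2 / 2 ^+ i.+1.
  rewrite /q -exprMn; case: (leP (2 * r i)) => _.
    apply: (@le_trans _ _ (f / 2 / 2 ^+ i.+1)).
      by rewrite -[X in _ <= X]expr1 ler_wiXn2l // ltW.
    by rewrite lerDr exprn_ge0 // mulr_ge0.
  by rewrite lerDl ltW.
have qsum n : \sum_(i < n) q i ^+ s <= f.
  apply: (@le_trans _ _ (\sum_(i < n) (2 ^+ s * r i ^+ s + f / 2 / 2 ^+ i.+1))).
    by apply: ler_sum => i _.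
  rewrite big_split /= -mulr_sumr.
  have h1 := half_series_le n (e := f / 2) (divr_ge0 (ltW f0) (ler0n _ _)).
  have h2 : 2 ^+ s * (\sum_(i < n) r i ^+ s) <= f / 2.
    apply: (@le_trans _ _ (2 ^+ s * (f / 2 ^+ s / 2))).
      by rewrite ler_wpM2l ?exprn_ge0.
    by rewrite mulrA mulrCA divff ?mulr1 // expf_neq0.
  lra.
exists a, q; split.
- move=> i; rewrite q0 /= -(ler_pXn2r s0) ?nnegrE ?(ltW d0) ?(ltW (q0 i)) //.
  apply: (@le_trans _ _ f); last by rewrite ge_min lexx orbT.
  apply: le_trans (qsum i.+1); rewrite big_ord_recr /= lerDr sumr_ge0 // => j _.
  by rewrite exprn_ge0 // ltW.
- move=> x /cov[i _ /= h]; exists i => //=.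
  rewrite lt_max; have [r_0|r_n0] := eqVneq (r i) 0.
    by rewrite r_0 in h; rewrite (le_lt_trans h (p0 i)) orbT.
  have : 0 < r i by rewrite lt_neqAle eq_sym r_n0 r0.
  by move=> ri; rewrite (@le_lt_trans _ _ (r i)) //; lra.
- by move=> n; apply: le_trans (qsum n) _; rewrite !ge_min lexx orbT.
Qed.

(* A pointwise condition suffices for images of null sets: a set splits into
   countably many pieces on which [L] and [d] are uniform. *)
Definition calm (V W : normedZmodType R) (f : V -> W) (x : V) : Prop :=
  exists L d : R, [/\ 0 <= L, 0 < d &
    forall y, `|y - x| <= d -> `|f y - f x| <= L * `|y - x|].

(** On [P j] the map is Lipschitz with constant j + 1 at distances up to 1 / (j + 1), so balls of
    radius at most half of that are carried into balls of comparable radius. *)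
Lemma hausdorff_null_image (V W : normedZmodType R) s (A : set V) (f : V -> W) :
  (0 < s)%N -> (forall x, A x -> calm f x) -> hausdorff_null s A ->
  hausdorff_null s (f @` A).
Proof.
move=> s0 fA hA.
pose P j := [set x | A x /\ forall y, `|y - x| <= j.+1%:R^-1 ->
   `|f y - f x| <= j.+1%:R * `|y - x|].
apply: (@hausdorff_null_sub _ _ _ (\bigcup_j (f @` P j))).
  move=> _ [x Ax <-]; have [L [d [L0 d0 h]]] := fA x Ax.
  pose j := Num.truncn (L + d^-1).
  have di : 0 < d^-1 by rewrite invr_gt0.
  have jb : L + d^-1 < j.+1%:R.
    by have /andP[_] := truncn_itv (addr_ge0 L0 (ltW di)).
  exists j => //; exists x => //; split=> // y hy.
  apply: (@le_trans _ _ (L * `|y - x|)).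
    apply: h; apply: le_trans hy _.
    by rewrite -[d]invrK lef_pV2 ?posrE //; lra.
  by rewrite ler_wpM2r //; lra.
apply: hausdorff_null_bigcup => // j e e0.
have J0 : 0 < j.+1%:R :> R by rewrite ltr0n.
have [||a [r [hr cov sum]]] := hausdorff_null_pos s0 hA (e := e / (2 * j.+1%:R) ^+ s)
   (d := (2 * j.+1%:R)^-1).
- by rewrite divr_gt0 // exprn_gt0 // mulr_gt0.
- by rewrite invr_gt0 mulr_gt0.
have r0 i : 0 < r i by case/andP: (hr i).
(* The centre [a i] need not lie in [P j], so the new centre is the image of some point of [P j] in
   the ball; this costs the factor 2. *)
have /choice[b hb] : forall i, exists b : W,
    forall x, P j x -> `|x - a i| < r i -> `|f x - b| <= 2 * j.+1%:R * r i.
  move=> i; have [[x0 [Px0 hx0]]|no] := pselect (exists x, P j x /\ `|x - a i| < r i); last first.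
    by exists 0 => x Px hx; exfalso; apply: no; exists x.
  exists (f x0) => x Px hx.
  have xx0 : `|x - x0| <= 2 * r i.
    rewrite -(subrK (a i) x) -addrA.
    apply: le_trans (ler_normD _ _) _.
    by move: hx0; rewrite distrC => hx0; lra.
  apply: (@le_trans _ _ (j.+1%:R * `|x - x0|)); last first.
    by rewrite -mulrA mulrCA ler_pM2l.
  case: Px0 => _; apply; apply: le_trans xx0 _.
  have /andP[_ ri] := hr i.
  apply: (@le_trans _ _ (2 * (2 * j.+1%:R)^-1)); first by rewrite ler_pM2l.
  by rewrite invfM mulrA divff // mul1r.
exists b, (fun i => 2 * j.+1%:R * r i); split.
- by move=> i; rewrite !mulr_ge0 // ltW.
- move=> _ [x Px <-]; have [Ax _] := Px.
  by have [i _ hi] := cov x Ax; exists i => //=; apply: hb.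
- move=> n; under eq_bigr do rewrite exprMn.
  by rewrite -mulr_sumr mulrC -ler_pdivlMr ?exprn_gt0 ?mulr_gt0.
Qed.

(** A ball of radius r <= 1 times [-M, M] is covered by at most 2 M / r + 1 balls of radius r, which
    contribute at most (2 M + 1) r^s to the sum of the powers s + 1. *)
Lemma hausdorff_null_prod (V : normedZmodType R) s (A : set V) (M : R) :
  (0 < s)%N -> hausdorff_null s A ->
  hausdorff_null s.+1 [set x : V * R | A x.1 /\ `|x.2| <= M].
Proof.
move=> s0 hA; have [M0|M0] := ltP M 0.
  apply: (@hausdorff_null_sub _ _ _ set0).
    by move=> [x u] [_ /= h]; have := le_lt_trans (le_trans (normr_ge0 u) h) M0; rewrite ltxx.
  move=> e e0; exists (fun=> 0), (fun=> 0); split=> // n.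
  by rewrite big1 ?ltW // => i _; rewrite expr0n.
apply: hausdorff_null_double => // e e0.
have M1 : 0 < 2 * M + 1 by lra.
have [||a [r [hr cov sum]]] := hausdorff_null_pos s0 hA (e := e / (2 * M + 1)) (d := 1).
- by rewrite divr_gt0.
- by [].
have r0 i : 0 < r i by case/andP: (hr i).
pose N i := Num.truncn (2 * M / r i).
have N0 i : 0 <= 2 * M / r i by rewrite divr_ge0 ?mulr_ge0 // ltW.
exists (fun i j => (a i, - M + r i * j%:R)),
  (fun i j => if (j <= N i)%N then r i else 0); split.
- by move=> i j; case: ifP => // _; rewrite ltW.
- move=> [x u] [/= Ax hu]; have [i _ hi] := cov x Ax.
  move: hu; rewrite ler_norml => /andP[hu1 hu2].
  have T0 : 0 <= (u + M) / r i by rewrite divr_ge0 ?(ltW (r0 i)) //; lra.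
  have /andP[t1 t2] := truncn_itv T0.
  set j := Num.truncn _ in t1 t2.
  exists i => //; exists j => //=.
  have -> : (j <= N i)%N.
    by apply: le_truncn; rewrite ler_pM2r ?invr_gt0 //; lra.
  rewrite prod_normE ge_max /= ltW //=.
  rewrite ler_pdivlMr // in t1; rewrite ltr_pdivrMr // -natr1 mulrDl mul1r in t2.
  rewrite ler_norml; apply/andP; split; lra.
- move=> n p.
  apply: (@le_trans _ _ (\sum_(i < n) (2 * M + 1) * r i ^+ s)); last first.
    by rewrite -mulr_sumr mulrC -ler_pdivlMr.
  apply: ler_sum => i _.
  apply: (@le_trans _ _ (\sum_(j < (N i).+1) r i ^+ s.+1)).
    pose g j : R := (if (j <= N i)%N then r i else 0) ^+ s.+1.
    have g0 j : 0 <= g j by rewrite /g exprn_ge0 //; case: ifP => // _; rewrite ltW.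
    apply: (@le_trans _ _ (\sum_(j < maxn p (N i).+1) g j)).
      rewrite (big_ord_widen _ g (leq_maxl p (N i).+1)) [leLHS]big_mkcond /=.
      by apply: ler_sum => j _; case: ifP.
    rewrite [leRHS](big_ord_widen _ (fun=> r i ^+ s.+1) (leq_maxr p (N i).+1)).
    rewrite [leRHS]big_mkcond /=; apply: ler_sum => j _.
    by rewrite /g ltnS; case: ifP => // _; rewrite expr0n.
  rewrite sumr_const card_ord -[_ *+ (N i).+1]mulr_natl exprS mulrA ler_pM2r ?exprn_gt0 //.
  have /andP[+ _] := truncn_itv (N0 i); rewrite -/(N i) ler_pdivlMr // => h.
  rewrite -natr1 mulrDl mul1r; have /andP[_] := hr i; lra.
Qed.

End HausdorffNull.

(** * Pointwise Lipschitz maps *)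

Section Calm.
Context (R : realType) (V : normedZmodType R).
Implicit Types (f g : V -> R) (x : V).

Lemma calm_lipschitz (W : normedZmodType R) (L : R) (f : V -> W) x : 0 <= L ->
  (forall y, `|f y - f x| <= L * `|y - x|) -> calm f x.
Proof. by move=> L0 h; exists L, 1. Qed.

Lemma calm_cst (a : R) x : calm (fun=> a) x.
Proof. by apply: (@calm_lipschitz _ 0) => // y; rewrite subrr normr0 mul0r. Qed.

Lemma calm_ext (W : normedZmodType R) (f g : V -> W) x : f =1 g -> calm g x -> calm f x.
Proof. by move=> /funext ->. Qed.

Lemma calmN f x : calm f x -> calm (fun y => - f y) x.
Proof.
move=> [L [d [L0 d0 h]]]; exists L, d; split=> // y /h.
by rewrite -opprD normrN.
Qed.

Lemma calmD f g x : calm f x -> calm g x -> calm (fun y => f y + g y) x.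
Proof.
move=> [L [d [L0 d0 h]]] [L' [d' [L'0 d'0 h']]].
exists (L + L'), (Num.min d d'); split; [exact: addr_ge0|by rewrite lt_min d0|].
move=> y; rewrite le_min => /andP[/h hf /h' hg].
rewrite opprD addrACA mulrDl.
exact: le_trans (ler_normD _ _) (lerD hf hg).
Qed.

Lemma calmB f g x : calm f x -> calm g x -> calm (fun y => f y - g y) x.
Proof. by move=> hf /calmN; apply: calmD. Qed.

Lemma calmM f g x : calm f x -> calm g x -> calm (fun y => f y * g y) x.
Proof.
move=> [L [d [L0 d0 h]]] [L' [d' [L'0 d'0 h']]].
exists ((`|f x| + L * d) * L' + `|g x| * L), (Num.min d d'); split.
- by rewrite addr_ge0 ?mulr_ge0 ?addr_ge0 ?mulr_ge0 // ltW.
- by rewrite lt_min d0.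
move=> y; rewrite le_min => /andP[yd /h' hg]; have hf := h y yd.
have -> : f y * g y - f x * g x = f y * (g y - g x) + g x * (f y - f x) by ring.
apply: le_trans (ler_normD _ _) _; rewrite !normrM mulrDl.
have fy : `|f y| <= `|f x| + L * d.
  rewrite -[f y](subrK (f x)) addrC; apply: le_trans (ler_normD _ _) _.
  by rewrite lerD2l; apply: le_trans hf _; rewrite ler_wpM2l.
apply: lerD; last by rewrite -mulrA ler_wpM2l.
by rewrite -mulrA; apply: ler_pM.
Qed.

Lemma calmV f x : f x != 0 -> calm f x -> calm (fun y => (f y)^-1) x.
Proof.
move=> fx0 [L [d [L0 d0 h]]].
have nf : 0 < `|f x| by rewrite normr_gt0.
have L1 : 0 < L + 1 by lra.
exists (2 / `|f x| ^+ 2 * L), (Num.min d (`|f x| / 2 / (L + 1))); split.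
- by rewrite mulr_ge0 // divr_ge0 // exprn_ge0.
- by rewrite lt_min d0 !divr_gt0.
move=> y; rewrite le_min => /andP[yd yd']; have hf := h y yd.
rewrite ler_pdivlMr // in yd'.
have hf2 : `|f y - f x| <= `|f x| / 2.
  apply: le_trans hf (le_trans _ yd').
  by rewrite mulrC ler_wpM2l //; lra.
have fy : `|f x| / 2 <= `|f y|.
  have := ler_normD (f y) (f x - f y); rewrite addrC subrK distrC; lra.
have nfy : 0 < `|f y| by lra.
have fy0 : f y != 0 by rewrite -normr_gt0.
have -> : (f y)^-1 - (f x)^-1 = - (f y - f x) / (f y * f x).
  by field; rewrite fx0.
rewrite normrM normrN normfV normrM.
rewrite ler_pdivrMr ?mulr_gt0 //; apply: le_trans hf _.
have -> : L * `|y - x| = 2 / `|f x| ^+ 2 * L * `|y - x| * (`|f x| / 2 * `|f x|).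
  by field; rewrite gt_eqF.
rewrite ler_wpM2l ?ler_wpM2r //.
by rewrite !mulr_ge0 // divr_ge0 // exprn_ge0.
Qed.

(** The difference of the roots times sqrt(f x) is at most |f y - f x|. This includes negative
    [f y], where [Num.sqrt] is 0 and f x <= f x - f y. *)
Lemma calm_sqrt f x : 0 < f x -> calm f x -> calm (fun y => Num.sqrt (f y)) x.
Proof.
move=> fx0 [L [d [L0 d0 h]]].
have s0 : 0 < Num.sqrt (f x) by rewrite sqrtr_gt0.
exists (L / Num.sqrt (f x)), d; split=> //; first by rewrite divr_ge0 // ltW.
move=> y /h hf; rewrite mulrAC ler_pdivlMr //.
apply: le_trans hf.
have sx := sqr_sqrtr (ltW fx0).
have [fy|fy] := leP 0 (f y); last first.
  rewrite [Num.sqrt (f y)]ler0_sqrtr ?ltW // sub0r normrN gtr0_norm //.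
  by rewrite -expr2 sx distrC ger0_norm; lra.
have sy := sqr_sqrtr fy; have sy0 := sqrtr_ge0 (f y).
rewrite -[in leRHS]sx -[in leRHS]sy subr_sqr normrM.
rewrite ler_wpM2l // ger0_norm; lra.
Qed.

End Calm.

Section StateNorm.
Context (R : realType).
Implicit Types x : state R.

Lemma pos_norm_le x i : `|pos x i| <= `|x|.
Proof.
rewrite prod_normE le_max; apply/orP; left.
rewrite /Num.norm /= mx_normrE.
exact: (le_bigmax _ (fun ij : 'I_1 * 'I_3 => `|x.1 ij.1 ij.2|) (ord0, i)).
Qed.

Lemma mom_norm_le x i : `|mom x i| <= `|x|.
Proof.
rewrite prod_normE le_max; apply/orP; right.
rewrite /Num.norm /= mx_normrE.
exact: (le_bigmax _ (fun ij : 'I_1 * 'I_3 => `|x.2 ij.1 ij.2|) (ord0, i)).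
Qed.

Lemma state_norm_le x (b : R) : 0 <= b ->
  (forall i, `|pos x i| <= b) -> (forall i, `|mom x i| <= b) -> `|x| <= b.
Proof.
move=> b0 hq hp; rewrite prod_normE ge_max; apply/andP; split;
  rewrite /Num.norm /= mx_normrE; apply/bigmax_leP; split=> // -[j i] _ /=;
  rewrite (ord1 j); [exact: hq|exact: hp].
Qed.

Lemma posB x y i : pos (x - y) i = pos x i - pos y i.
Proof. by rewrite /pos !mxE. Qed.

Lemma momB x y i : mom (x - y) i = mom x i - mom y i.
Proof. by rewrite /mom !mxE. Qed.

Lemma calm_pos i x : calm (fun y : state R => pos y i) x.
Proof.
apply: (@calm_lipschitz _ _ _ 1) => // y.
by rewrite mul1r -posB pos_norm_le.
Qed.

Lemma calm_mom i x : calm (fun y : state R => mom y i) x.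
Proof.
apply: (@calm_lipschitz _ _ _ 1) => // y.
by rewrite mul1r -momB mom_norm_le.
Qed.

Lemma calm_vel m i x : calm (fun y : state R => vel m y i) x.
Proof. exact: calmM (calm_mom i x) (calm_cst _ _). Qed.

Lemma calm_uniform (V : normedZmodType R) (f : 'I_3 -> V -> R) (x : V) :
  (forall i, calm (f i) x) -> exists L d : R, [/\ 0 <= L, 0 < d &
    forall i y, `|y - x| <= d -> `|f i y - f i x| <= L * `|y - x|].
Proof.
move=> hf.
have [L1 [d1 [L10 d10 h1]]] := hf i1.
have [L2 [d2 [L20 d20 h2]]] := hf i2.
have [L3 [d3 [L30 d30 h3]]] := hf i3.
exists (L1 + L2 + L3), (Num.min d1 (Num.min d2 d3)); split.
- by rewrite !addr_ge0.
- by rewrite !lt_min d10 d20 d30.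
move=> i y; rewrite !le_min => /and3P[y1 y2 y3]; move: i.
apply: all_i3; [move: (h1 y y1)|move: (h2 y y2)|move: (h3 y y3)] => h;
  apply: le_trans h _; rewrite ler_wpM2r //; lra.
Qed.

Lemma calm_state (V : normedZmodType R) (f : V -> state R) (x : V) :
  (forall i, calm (fun y => pos (f y) i) x) ->
  (forall i, calm (fun y => mom (f y) i) x) -> calm f x.
Proof.
move=> /calm_uniform[L [d [L0 d0 hq]]] /calm_uniform[L' [d' [L'0 d'0 hp]]].
exists (L + L'), (Num.min d d'); split; [exact: addr_ge0|by rewrite lt_min d0|].
move=> y; rewrite le_min => /andP[yd yd'].
apply: state_norm_le => [|i|i]; first by rewrite mulr_ge0 ?addr_ge0.
  rewrite posB mulrDl; apply: le_trans (hq i y yd) _.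
  by rewrite lerDl mulr_ge0.
rewrite momB mulrDl; apply: le_trans (hp i y yd') _.
by rewrite lerDr mulr_ge0.
Qed.

End StateNorm.

(** The origin of the line has 1-dimensional measure 0, and each of the two products with a bounded
    interval raises the exponent by one. *)
Lemma hausdorff_null_plane (R : realType) :
  hausdorff_null 3 [set x : R * R * R | x.1.1 = 0].
Proof.
have h1 : hausdorff_null 1 [set 0 : R].
  move=> e e0; exists (fun=> 0), (fun=> 0); split=> //.
    by move=> _ ->; exists 0%N => //=; rewrite subrr normr0.
  by move=> n; rewrite big1 ?ltW // => i _; rewrite expr1.
pose A M := [set x : R * R * R | [set u : R * R | [set 0] u.1 /\ `|u.2| <= M%:R] x.1 /\ `|x.2| <= M%:R].
apply: (@hausdorff_null_sub _ _ _ _ (\bigcup_M A M)); last first.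
  apply: hausdorff_null_bigcup => // M.
  by apply: hausdorff_null_prod => //; apply: hausdorff_null_prod.
move=> [[a b] d] /= ->.
exists (Num.truncn (`|b| + `|d|)).+1 => //=.
have /andP[_ h] := truncn_itv (addr_ge0 (normr_ge0 b) (normr_ge0 d)).
by split; [split|] => //=; apply: le_trans (ltW h); rewrite ?lerDl ?lerDr.
Qed.

(** * Nullity of the states that lead to a stop *)

Section BadNull.
Context (R : realType) (m : 'I_3 -> R) (c : R).
Context (m_gt0 : forall i, 0 < m i).
Implicit Types (x y z : state R) (k : collision).

Lemma calm_vel_collision k i x :
  calm (fun y : state R => vel m (collision_map m k y) i) x.
Proof.
have cv j := @calm_vel R m j x.
have cc a := @calm_cst R (state R) a x.
case: k; move: i; apply: all_i3.
- by apply: (calm_ext (g := fun y => - vel m y i1)) => [y|];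
    [have [] := vel_floor m_gt0 y|exact: calmN].
- by apply: (calm_ext (g := fun y => vel m y i2)) => // y; have [] := vel_floor m_gt0 y.
- by apply: (calm_ext (g := fun y => vel m y i3)) => // y; have [] := vel_floor m_gt0 y.
- apply: (calm_ext (g := fun y => gamma m i1 i2 * vel m y i1 +
    (1 - gamma m i1 i2) * vel m y i2)) => [y|]; first by have [] := vel_balls12 m_gt0 y.
  by apply: calmD; apply: calmM.
- apply: (calm_ext (g := fun y => (1 + gamma m i1 i2) * vel m y i1 -
    gamma m i1 i2 * vel m y i2)) => [y|]; first by have [] := vel_balls12 m_gt0 y.
  by apply: calmB; apply: calmM.
- by apply: (calm_ext (g := fun y => vel m y i3)) => // y; have [] := vel_balls12 m_gt0 y.
- by apply: (calm_ext (g := fun y => vel m y i1)) => // y; have [] := vel_balls23 m_gt0 y.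
- apply: (calm_ext (g := fun y => gamma m i2 i3 * vel m y i2 +
    (1 - gamma m i2 i3) * vel m y i3)) => [y|]; first by have [] := vel_balls23 m_gt0 y.
  by apply: calmD; apply: calmM.
- apply: (calm_ext (g := fun y => (1 + gamma m i2 i3) * vel m y i2 -
    gamma m i2 i3 * vel m y i3)) => [y|]; first by have [] := vel_balls23 m_gt0 y.
  by apply: calmB; apply: calmM.
Qed.

Lemma calm_back_time k0 k x : back_dom m k0 (collision_map m k x) ->
  calm (fun y : state R => back_time m k0 (collision_map m k y)) x.
Proof.
have cv j := @calm_vel_collision k j x.
have cp j : calm (fun y => pos (collision_map m k y) j) x by exact: calm_pos.
case: k0 => /= h.
- apply: calmB => //; apply: calm_sqrt => //.
  by apply: calmD; [apply: calmM|apply: calmM => //; exact: calm_cst].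
- by apply: calmM; [exact: calmB|apply: calmV => //; exact: calmB].
- by apply: calmM; [exact: calmB|apply: calmV => //; exact: calmB].
Qed.

Lemma calm_back_step k0 k x : back_dom m k0 (collision_map m k x) ->
  calm (back_step m k0 k) x.
Proof.
move=> /calm_back_time/calmN ct.
have cv j := @calm_vel_collision k j x.
apply: calm_state => i.
- apply: (calm_ext (g := fun y => pos y i +
    - back_time m k0 (collision_map m k y) * vel m (collision_map m k y) i -
    - back_time m k0 (collision_map m k y) * - back_time m k0 (collision_map m k y) / 2)).
    by move=> y; rewrite /back_step pos_free_flow // expr2.
  apply: calmB; first by apply: calmD; [exact: calm_pos|exact: calmM].
  by apply: calmM; [exact: calmM|exact: calm_cst].
- apply: (calm_ext (g := fun y => m i * vel m (collision_map m k y) i -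
    - back_time m k0 (collision_map m k y) * m i)).
    by move=> y; rewrite /back_step mom_free_flow (momE m_gt0).
  by apply: calmB; apply: calmM => //; exact: calm_cst.
Qed.

Lemma calm_row3 (V : normedZmodType R) (a b d : V -> R) (x : V) :
  calm a x -> calm b x -> calm d x ->
  forall i, calm (fun v => row3 (a v) (b v) (d v) ord0 i) x.
Proof.
move=> ca cb cd; apply: all_i3.
- by apply: (calm_ext (g := a)) => // v; rewrite row3E.
- by apply: (calm_ext (g := b)) => // v; rewrite row3E.
- by apply: (calm_ext (g := d)) => // v; rewrite row3E.
Qed.

Lemma pos_row3 (a b d : R) (p : 'rV[R]_3) :
  (pos (row3 a b d, p) i1 = a) * (pos (row3 a b d, p) i2 = b) *
  (pos (row3 a b d, p) i3 = d).
Proof. by rewrite /pos /= !row3E. Qed.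

Lemma mom_row3 (a b d : R) (q : 'rV[R]_3) :
  (mom (q, row3 a b d) i1 = a) * (mom (q, row3 a b d) i2 = b) *
  (mom (q, row3 a b d) i3 = d).
Proof. by rewrite /mom /= !row3E. Qed.

(** With q_1 = p_1 = 0 and one more coincidence of positions, the energy fixes the remaining height,
    so p_2 and p_3 are the only parameters. The first coordinate of the plane is a dummy. *)
Lemma hausdorff_null_dead : hausdorff_null 3 (dead m c).
Proof.
pose g (M : R) (w : R * R * R) : R :=
  (c - w.1.2 * w.1.2 / (2 * m i2) - w.2 * w.2 / (2 * m i3)) / M.
have cf (w : R * R * R) : calm (fun v : R * R * R => v.1.2) w.
  apply: (@calm_lipschitz _ _ _ 1) => // v; rewrite mul1r.
  by rewrite [`|v - w|]prod_normE le_max [`|(v - w).1|]prod_normE le_max lexx orbT.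
have cs (w : R * R * R) : calm (fun v : R * R * R => v.2) w.
  apply: (@calm_lipschitz _ _ _ 1) => // v; rewrite mul1r.
  by rewrite [`|v - w|]prod_normE le_max lexx orbT.
have cc (a : R) (w : R * R * R) : calm (fun=> a) w by exact: calm_cst.
have cg M w : calm (g M) w.
  by apply: calmM => //; apply: calmB; [apply: calmB => //|]; apply: calmM => //; apply: calmM.
pose f1 (w : R * R * R) : state R := (row3 0 0 (g (m i3) w), row3 0 w.1.2 w.2).
pose f2 (w : R * R * R) : state R :=
  (row3 0 (g (m i2 + m i3) w) (g (m i2 + m i3) w), row3 0 w.1.2 w.2).
apply: (@hausdorff_null_sub _ _ _ _ ((f1 @` [set x : R * R * R | x.1.1 = 0]) `|`
   (f2 @` [set x : R * R * R | x.1.1 = 0]))); last first.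
  apply: hausdorff_nullU => //; apply: hausdorff_null_image => //;
    try exact: hausdorff_null_plane; move=> w _; apply: calm_state;
    by apply: calm_row3 => //; exact: cg.
move=> x [hH q1 p1 [q12|q23]]; [left|right]; exists (0, mom x i2, mom x i3) => //.
- move: hH; rewrite hamiltonianE p1 q1 -q12 q1 => hH.
  apply: state_ext; apply: all_i3; rewrite ?pos_row3 ?mom_row3 //.
    by rewrite -q12.
  by rewrite /g /= -hH; field; rewrite !m_neq0.
- move: hH; rewrite hamiltonianE p1 q1 -q23 => hH.
  have E : g (m i2 + m i3) (0, mom x i2, mom x i3) = pos x i2.
    by rewrite /g /= -hH; field; rewrite !m_neq0 // mD_neq0.
  by apply: state_ext; apply: all_i3; rewrite ?pos_row3 ?mom_row3 // E ?q23.
Qed.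

Definition collision_of_nat (n : nat) : collision :=
  match n with 0%N => Floor | 1%N => Balls12 | _ => Balls23 end.

Lemma collision_of_nat_surj k : exists n, collision_of_nat n = k.
Proof. by case: k; [exists 0%N|exists 1%N|exists 2%N]. Qed.

Lemma hausdorff_null_bad n : hausdorff_null 3 (bad m c n).
Proof.
elim: n => [|n IH]; first exact: hausdorff_null_dead.
apply: (@hausdorff_null_sub _ _ _ _ (\bigcup_i \bigcup_j
  (back_step m (collision_of_nat i) (collision_of_nat j) @`
     [set y | bad m c n y /\ back_dom m (collision_of_nat i) (collision_map m (collision_of_nat j) y)]))).
  move=> x [k0 [sx [z [k [y [st hb]]]]]].
  have [hd hx] := poincare_step_back m_gt0 sx st.
  have [i ki] := collision_of_nat_surj k0; have [j kj] := collision_of_nat_surj k.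
  by exists i => //; exists j => //; exists y; rewrite ki kj.
apply: hausdorff_null_bigcup => // i; apply: hausdorff_null_bigcup => // j.
apply: hausdorff_null_image => // [y [_ hd]|]; first exact: calm_back_step.
by apply: hausdorff_null_sub IH => y [].
Qed.

Lemma hausdorff_null_all_bad : hausdorff_null 3 (\bigcup_n bad m c n).
Proof. by apply: hausdorff_null_bigcup => // n; exact: hausdorff_null_bad. Qed.

End BadNull.

(** * Lebesgue measure on the faces *)

Import HBNNSimple.
(** Neither [D] nor [f] is assumed measurable: the integral is a supremum over simple functions
    below [f] on [D], and a level set of such a function at a nonzero value is a measurable subset
    of [D]. *)
Lemma null_set_ge0_integral d (T : measurableType d) (R : realType)
    (nu : {measure set T -> \bar R}) (D : set T) (f : T -> \bar R) :
  nu.-null_set D -> (forall x, D x -> (0 <= f x)%E) ->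
  (\int[nu]_(x in D) f x = 0)%E.
Proof.
move=> D0 f0; rewrite ge0_integralE //.
apply/eqP; rewrite eq_le; apply/andP; split.
  apply/ge_ereal_sup => _ [h hf <-].
  rewrite sintegralE fsbig1 // => r _; have [->|r0] := eqVneq r 0.
    by rewrite mul0e.
  rewrite [X in (_ * X)%E](_ : _ = 0%E) ?mule0 //; apply: D0 => [|x /= hx].
    by apply: measurable_funPTI; exact: measurable_set1.
  apply: contrapT => nDx.
  have := hf x; rewrite patchE memNset // lee_fin hx => r_le0.
  have : 0 <= h x by [].
  by rewrite hx => r_ge0; case/eqP: r0; apply/eqP; rewrite eq_le r_le0.
by apply: ereal_sup_ubound; exists nnsfun0; [move=> x /=; rewrite patchE; case: ifPn => // /set_mem /f0|exact: sintegral0].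
Qed.

Section Lebesgue4.
Context (R : realType).

Definition box4 (a : R * R * R * R) (l : R) : set (R4 R) :=
  [set` `[a.1.1.1, a.1.1.1 + l]] `*` [set` `[a.1.1.2, a.1.1.2 + l]]
   `*` [set` `[a.1.2, a.1.2 + l]] `*` [set` `[a.2, a.2 + l]].

Lemma measurable_box4 a l : measurable (box4 a l).
Proof.
by rewrite /box4; do ?[apply: measurableX]; apply: measurable_itv.
Qed.

Lemma lebesgue4_box4 a l : 0 < l -> lebesgue4 R (box4 a l) = (l ^+ 4)%:E.
Proof.
move=> l0.
have itv b : @lebesgue_measure R [set` `[b, b + l]] = l%:E.
  by rewrite lebesgue_measure_itv /= lte_fin ltrDl l0 -EFinB addrC addKr.
rewrite /box4 /lebesgue4 /=.
rewrite product_measure1E; [|by do ?[apply: measurableX]; apply: measurable_itv|exact: measurable_itv].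
rewrite /= product_measure1E; [|by do ?[apply: measurableX]; apply: measurable_itv|exact: measurable_itv].
rewrite /= product_measure1E; [|exact: measurable_itv|exact: measurable_itv].
by rewrite /= !itv -!EFinM !exprS expr0 mulr1 !mulrA.
Qed.

(** The product norm is a maximum, so balls are cubes of side 2 r and volume 16 r^4. *)
Lemma lebesgue4_null (A : set (R * R * R * R)) :
  hausdorff_null 4 A -> (lebesgue4 R).-null_set (A : set (R4 R)).
Proof.
move=> hA E mE EA.
suff small (e : R) : 0 < e -> (lebesgue4 R E <= e%:E)%E.
  apply/eqP; rewrite eq_le measure_ge0 andbT.
  by apply/lee_addgt0Pr => e e0; rewrite add0e; apply: small.
move=> e0.
have [||a [r [hr cov sum]]] := hausdorff_null_pos (ltn0Sn 3) hA (e := e / 16) (d := 1) => //.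
  by rewrite divr_gt0.
have r0 i : 0 < r i by case/andP: (hr i).
pose lo i : R * R * R * R :=
  ((a i).1.1.1 - r i, (a i).1.1.2 - r i, (a i).1.2 - r i, (a i).2 - r i).
have covE : E `<=` \bigcup_i box4 (lo i) (2 * r i).
  move=> x /EA/cov[i _ /= h]; exists i => //.
  move: h; rewrite !prod_normE !gt_max => /andP[/andP[/andP[h1 h2] h3] h4].
  rewrite /box4 /lo /= !in_itv /=.
  move: h1 h2 h3 h4; rewrite !ltr_norml => /andP[? ?] /andP[? ?] /andP[? ?] /andP[? ?].
  by do ?split; apply/andP; split; lra.
apply: le_trans (measure_sigma_subadditive _ _ mE covE) _.
  by move=> i; exact: measurable_box4.
apply: lime_le; first by apply: is_cvg_nneseries => i _ _; exact: measure_ge0.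
apply: nearW => n.
rewrite big_mkord (eq_bigr (fun i : 'I_n => (16 * r i ^+ 4)%:E)) => [|i _].
  apply: (@le_trans _ _ ((\sum_(i < n) 16 * r i ^+ 4)%:E)).
    by rewrite -sumEFin; exact: lexx.
  by rewrite lee_fin -mulr_sumr mulrC -ler_pdivlMr.
by rewrite lebesgue4_box4 ?mulr_gt0 // exprMn -[2 ^+ 4]natrX.
Qed.

Lemma box4_not_null (A : set (R * R * R * R)) a l : 0 < l ->
  hausdorff_null 4 A -> exists2 u, box4 a l u & ~ A u.
Proof.
move=> l0 /lebesgue4_null nA; apply: contrapT => no.
have sub : box4 a l `<=` A.
  by move=> u bu; apply: contrapT => nAu; apply: no; exists u.
have := nA _ (measurable_box4 a l) sub.
rewrite lebesgue4_box4 // => -[] /eqP; rewrite expf_eq0 /= gt_eqF //.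
Qed.

End Lebesgue4.

(** [full_measure] asks for a Borel null set, which is obtained here as a countable intersection of
    open covers with sums tending to 0. *)
Lemma hausdorff_null_hull (R : realType) (V : normedModType R) s (A : set V) :
  (0 < s)%N -> hausdorff_null s A ->
  exists N : set V, [/\ A `<=` N, hausdorff_null s N & <<s @open V >> N].
Proof.
move=> s0 hA.
have /choice[ar har] : forall n : nat, exists ar : (nat -> V) * (nat -> R),
    [/\ forall i, 0 < ar.2 i <= 1,
        A `<=` \bigcup_i [set x | `|x - ar.1 i| < ar.2 i] &
        forall p, \sum_(i < p) ar.2 i ^+ s <= n.+1%:R^-1].
  move=> n; have [||a [r h]] := hausdorff_null_pos s0 hA (e := n.+1%:R^-1) (d := 1) => //.
  by exists (a, r).
pose U n := \bigcup_i [set x | `|x - (ar n).1 i| < (ar n).2 i].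
exists (\bigcap_n U n); split.
- by move=> x Ax n _; case: (har n) => _ /(_ x Ax).
- move=> e e0; pose n := Num.truncn e^-1.
  have hn : n.+1%:R^-1 <= e.
    rewrite -[e]invrK lef_pV2 ?posrE ?invr_gt0 //.
    have e1 : 0 <= e^-1 by rewrite invr_ge0 ltW.
    by have /andP[_ /ltW] := truncn_itv e1.
  have [h1 h2 h3] := har n.
  exists (ar n).1, (ar n).2; split.
  + by move=> i; case/andP: (h1 i) => /ltW.
  + by move=> x /(_ n I)[i _ /= /ltW h]; exists i.
  + by move=> p; apply: le_trans (h3 p) hn.
- have oU n : open (U n).
    apply: bigcup_open => i _.
    rewrite (_ : [set x | _] = ball ((ar n).1 i) ((ar n).2 i)).
      by apply: ball_open; case: (har n) => /(_ i)/andP[].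
    by rewrite -ball_normE; apply/seteqP; split=> x /=; rewrite distrC.
  have -> : \bigcap_n U n = ~` (\bigcup_n ~` U n) by rewrite setC_bigcup; apply: eq_bigcapr => n _; rewrite setCK.
  apply: sigma_algebraC; apply: sigma_algebra_bigcup => n.
  by apply: sigma_algebraC; apply: sub_sigma_algebra.
Qed.

(** * The charts of the faces *)

Section Charts.
Context (R : realType) (m : 'I_3 -> R) (c : R).
Context (m_gt0 : forall i, 0 < m i).
Implicit Types (x : state R) (k : collision) (u : R * R * R * R).

Definition chart k u : state R := face_chart m c k u.1.1.1 u.1.1.2 u.1.2 u.2.

Definition kinetic k u : R := face_kinetic m c k u.1.1.1 u.1.1.2 u.1.2 u.2.

Definition face_coord k x : R * R * R * R := match k with
  | Floor => (pos x i2, mom x i2, pos x i3, mom x i3)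
  | Balls12 => (pos x i1, mom x i1 + mom x i2, pos x i3, mom x i3)
  | Balls23 => (pos x i1, mom x i1, pos x i2, mom x i2 + mom x i3)
  end.

(** The square root enters only the momentum of ball 1, resp. the relative momentum, which
    [face_coord] does not see; hence no condition on the sign of the kinetic energy. *)
Lemma chartK k : cancel (chart k) (face_coord k).
Proof.
move=> [[[a b] d] e]; have n12 := mD_neq0 m_gt0 i1 i2; have n23 := mD_neq0 m_gt0 i2 i3.
case: k; rewrite /chart /face_coord /= !pos_row3 ?mom_row3 //.
- by congr (_, _, _, _); field.
- by congr (_, _); field.
Qed.

Lemma chart_energy k u : 0 <= kinetic k u -> hamiltonian m (chart k u) = c.
Proof.
have n12 := mD_neq0 m_gt0 i1 i2; have n23 := mD_neq0 m_gt0 i2 i3.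
have [n1 n2 n3] : [/\ m i1 != 0, m i2 != 0 & m i3 != 0] by split; apply: m_neq0.
case: u => [[[a b] d] e]; rewrite /kinetic /chart.
have p0 i j : 0 <= m i * m j / (m i + m j).
  by rewrite divr_ge0 ?mulr_ge0 ?addr_ge0 // ltW.
case: k; rewrite hamiltonianE; cbn -[face_kinetic row3]; set K := face_kinetic _ _ _ _ _ _ _ => K0;
  rewrite !pos_row3 !mom_row3.
- rewrite sqr_sqrtr; last by rewrite !mulr_ge0 // ltW.
  by rewrite /K /=; field; rewrite n1 n2 n3.
- have := @sqr_sqrtr R (2 * (m i1 * m i2 / (m i1 + m i2)) * K).
  set r := Num.sqrt _ => r2.
  transitivity (b ^+ 2 / (2 * (m i1 + m i2)) + r ^+ 2 * ((m i1 + m i2) / (2 * m i1 * m i2))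
     + (m i1 + m i2) * a + (e ^+ 2 / (2 * m i3) + m i3 * d)).
    by field; rewrite n1 n2 n3.
  rewrite r2; last by apply: mulr_ge0 => //; apply: mulr_ge0.
  by rewrite /K /=; field; rewrite n1 n2 n3.
- have := @sqr_sqrtr R (2 * (m i2 * m i3 / (m i2 + m i3)) * K).
  set r := Num.sqrt _ => r2.
  transitivity (e ^+ 2 / (2 * (m i2 + m i3)) + r ^+ 2 * ((m i2 + m i3) / (2 * m i2 * m i3))
     + (m i2 + m i3) * d + (b ^+ 2 / (2 * m i1) + m i1 * a)).
    by field; rewrite n1 n2 n3.
  rewrite r2; last by apply: mulr_ge0 => //; apply: mulr_ge0.
  by rewrite /K /=; field; rewrite n1 n2 n3.
Qed.

Lemma chart_vel k u : exists2 r : R,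
  r = Num.sqrt (kinetic k u * match k with Floor => 2 * m i1
      | Balls12 => 2 * (m i1 * m i2 / (m i1 + m i2))
      | Balls23 => 2 * (m i2 * m i3 / (m i2 + m i3)) end) &
  match k with
  | Floor => pos (chart k u) i1 = 0 /\ vel m (chart k u) i1 = r / m i1
  | Balls12 => pos (chart k u) i1 = pos (chart k u) i2 /\
      vel m (chart k u) i2 - vel m (chart k u) i1 = r * ((m i1)^-1 + (m i2)^-1)
  | Balls23 => pos (chart k u) i2 = pos (chart k u) i3 /\
      vel m (chart k u) i3 - vel m (chart k u) i2 = r * ((m i2)^-1 + (m i3)^-1)
  end.
Proof.
have n12 := mD_neq0 m_gt0 i1 i2; have n23 := mD_neq0 m_gt0 i2 i3.
have [n1 n2 n3] : [/\ m i1 != 0, m i2 != 0 & m i3 != 0] by split; apply: m_neq0.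
eexists; first reflexivity.
case: u => [[[a b] d] e].
case: k; rewrite /vel /kinetic /chart; cbn -[face_kinetic row3];
  rewrite !pos_row3 ?mom_row3 // [_ * (2 * _)]mulrC; split=> //.
- set r := Num.sqrt _; by field; rewrite n1 n2 n12.
- set r := Num.sqrt _; by field; rewrite n2 n3 n23.
Qed.

Lemma chart_coef_gt0 k : 0 < (match k with Floor => 2 * m i1
      | Balls12 => 2 * (m i1 * m i2 / (m i1 + m i2))
      | Balls23 => 2 * (m i2 * m i3 / (m i2 + m i3)) end).
Proof. by case: k; rewrite mulr_gt0 // divr_gt0 ?mulr_gt0 ?addr_gt0. Qed.

Lemma chart_strictly_after k u : 0 < kinetic k u -> strictly_after m k (chart k u).
Proof.
move=> K0; have [r rE] := chart_vel k u.
have r0 : 0 < r by rewrite rE sqrtr_gt0 mulr_gt0 // chart_coef_gt0.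
have im i : 0 < (m i)^-1 by rewrite invr_gt0.
case: k u K0 rE => u K0 rE [hq hv]; split=> //; [by rewrite hv; apply: mulr_gt0| |];
  by rewrite -subr_gt0 hv; apply: mulr_gt0 => //; apply: addr_gt0.
Qed.

Lemma chart_after k u : 0 <= u.1.1.1 -> u.1.1.1 <= u.1.2 -> 0 <= kinetic k u ->
  after_collision m c k (chart k u).
Proof.
move=> u1 u13 K0; have [r rE h] := chart_vel k u.
have r0 : 0 <= r by rewrite rE sqrtr_ge0.
have im i : 0 <= (m i)^-1 by rewrite invr_ge0 ltW.
split; first split; first exact: chart_energy.
  by clear r rE r0 h; case: k u u1 u13 K0 => u u1 u13 K0; rewrite /chart /= !pos_row3; split.
case: k u u1 u13 K0 rE h => u u1 u13 K0 rE [hq hv]; split=> //;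
    [by rewrite hv; apply: mulr_ge0| |];
  by rewrite -subr_ge0 hv; apply: mulr_ge0 => //; apply: addr_ge0.
Qed.

(** By energy conservation [kinetic] is m_1 v_1^2 / 2, resp. mu w^2 / 2 with the reduced mass mu and
    the relative velocity w; the sign condition of the face selects the nonnegative root. Grazing
    points are included. *)
Lemma face_coordK k x : after_collision m c k x ->
  let u := face_coord k x in
  [/\ chart k u = x, 0 <= u.1.1.1, u.1.1.1 <= u.1.2 & 0 <= kinetic k u].
Proof.
have n12 := mD_neq0 m_gt0 i1 i2; have n23 := mD_neq0 m_gt0 i2 i3.
have [n1 n2 n3] : [/\ m i1 != 0, m i2 != 0 & m i3 != 0] by split; apply: m_neq0.
move=> [[hH [q1 q12 q23]] hk]; set u := face_coord k x.
have p0 i j : 0 < m i * m j / (m i + m j).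
  by rewrite divr_gt0 ?mulr_gt0 ?addr_gt0.
have m1 := m_gt0 i1.
rewrite (hamiltonian_velE m_gt0) in hH.
case: k hk @u => -[hq hv] u; rewrite /u /=.
- have KE : kinetic Floor u = m i1 * vel m x i1 ^+ 2 / 2.
    by rewrite /kinetic /u /= -hH !(momE m_gt0) hq; field; rewrite n2 n3.
  split=> //.
  + apply: state_ext; apply: all_i3; rewrite ?pos_row3 ?mom_row3 //.
    rewrite [c - _ - _]KE (_ : _ * _ = (m i1 * vel m x i1) ^+ 2); last by field.
    by rewrite sqrtr_sqr ger0_norm ?(momE m_gt0) // mulr_ge0 // ltW.
  + exact: le_trans q1 q12.
  + by rewrite [c - _ - _]KE; apply: divr_ge0 => //; apply: mulr_ge0 (ltW m1) (sqr_ge0 _).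
- pose w := vel m x i2 - vel m x i1; pose mu := m i1 * m i2 / (m i1 + m i2).
  have KE : kinetic Balls12 u = mu * w ^+ 2 / 2.
    by rewrite /kinetic /u /= -hH !(momE m_gt0) -hq /w /mu; field; rewrite n12 n3.
  have w0 : 0 <= w by rewrite subr_ge0.
  have mu0 : 0 <= mu by exact: ltW (p0 _ _).
  have rE : Num.sqrt (2 * mu * (mu * w ^+ 2 / 2)) = mu * w.
    rewrite (_ : _ * _ = (mu * w) ^+ 2); last by field.
    by rewrite sqrtr_sqr ger0_norm // mulr_ge0.
  split=> //.
  + apply: state_ext; apply: all_i3; rewrite ?pos_row3 ?mom_row3 //.
      by rewrite [c - _ - _]KE -/mu rE !(momE m_gt0) /w /mu; field.
    by rewrite [c - _ - _]KE -/mu rE !(momE m_gt0) /w /mu; field.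
  + exact: le_trans q12 q23.
  + by rewrite [c - _ - _]KE; apply: divr_ge0 => //; apply: mulr_ge0 => //; exact: sqr_ge0.
- pose w := vel m x i3 - vel m x i2; pose mu := m i2 * m i3 / (m i2 + m i3).
  have KE : kinetic Balls23 u = mu * w ^+ 2 / 2.
    by rewrite /kinetic /u /= -hH !(momE m_gt0) -hq /w /mu; field; rewrite n23 n1.
  have w0 : 0 <= w by rewrite subr_ge0.
  have mu0 : 0 <= mu by exact: ltW (p0 _ _).
  have rE : Num.sqrt (2 * mu * (mu * w ^+ 2 / 2)) = mu * w.
    rewrite (_ : _ * _ = (mu * w) ^+ 2); last by field.
    by rewrite sqrtr_sqr ger0_norm // mulr_ge0.
  split=> //.
  + apply: state_ext; apply: all_i3; rewrite ?pos_row3 ?mom_row3 //.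
      by rewrite [c - _ - _]KE -/mu rE !(momE m_gt0) /w /mu; field.
    by rewrite [c - _ - _]KE -/mu rE !(momE m_gt0) /w /mu; field.
  + by rewrite [c - _ - _]KE; apply: divr_ge0 => //; apply: mulr_ge0 => //; exact: sqr_ge0.
Qed.

(** One form for all three faces, which shows that [kinetic] is a concave function of the chart
    parameters. *)
Lemma kineticE k : exists A B A' B' : R,
  [/\ 0 <= A, 0 <= B, 0 <= A', 0 <= B' & forall u,
    kinetic k u = c - (A * u.1.1.2 ^+ 2 + B * u.1.1.1)
                    - (A' * u.2 ^+ 2 + B' * u.1.2)].
Proof.
have i0 (M : R) : 0 < M -> 0 <= (2 * M)^-1 by move=> M0; rewrite invr_ge0 mulr_ge0 // ltW.
have [m1 m2 m3] : [/\ 0 < m i1, 0 < m i2 & 0 < m i3] by split; apply: m_gt0.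
have m12 := addr_gt0 m1 m2; have m23 := addr_gt0 m2 m3.
case: k.
- exists (2 * m i2)^-1, (m i2), (2 * m i3)^-1, (m i3); split; rewrite ?i0 ?ltW // => u.
  by rewrite /kinetic /= !(mulrC (_ ^-1)).
- exists (2 * (m i1 + m i2))^-1, (m i1 + m i2), (2 * m i3)^-1, (m i3).
  split; rewrite ?i0 ?(ltW m3) ?(ltW m12) // => u.
  by rewrite /kinetic /= !(mulrC (_ ^-1)).
- exists (2 * m i1)^-1, (m i1), (2 * (m i2 + m i3))^-1, (m i2 + m i3).
  split; rewrite ?i0 ?(ltW m1) ?(ltW m23) // => u.
  by rewrite /kinetic /= !(mulrC (_ ^-1)).
Qed.

End Charts.

Lemma hausdorff_nullS (R : realType) (V : normedZmodType R) s (A : set V) :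
  (0 < s)%N -> hausdorff_null s A -> hausdorff_null s.+1 A.
Proof.
move=> s0 hA e e0; have [|a [r [hr cov sum]]] := hausdorff_null_pos s0 hA e0 (d := 1) => //.
exists a, r; split.
- by move=> i; case/andP: (hr i) => /ltW.
- by move=> x /cov[i _ /= /ltW h]; exists i.
- move=> n; apply: le_trans (sum n); apply: ler_sum => i _.
  have /andP[r0 r1] := hr i.
  by rewrite exprS ler_piMl // exprn_ge0 // ltW.
Qed.

Lemma calm_pair (R : realType) (V W W' : normedZmodType R) (f : V -> W) (g : V -> W') x :
  calm f x -> calm g x -> calm (fun y => (f y, g y)) x.
Proof.
move=> [L [d [L0 d0 h]]] [L' [d' [L'0 d'0 h']]].
exists (L + L'), (Num.min d d'); split; [exact: addr_ge0|by rewrite lt_min d0|].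
move=> y; rewrite le_min => /andP[yd yd'].
rewrite prod_normE ge_max /= !mulrDl; apply/andP; split.
  by apply: le_trans (h y yd) _; rewrite lerDl mulr_ge0.
by apply: le_trans (h' y yd') _; rewrite lerDr mulr_ge0.
Qed.

Lemma calm_comp (R : realType) (V W W' : normedZmodType R) (f : V -> W) (g : W -> W') x :
  calm f x -> calm g (f x) -> calm (g \o f) x.
Proof.
move=> [L [d [L0 d0 h]]] [L' [d' [L'0 d'0 h']]].
have L1 : 0 < L + 1 by lra.
exists (L' * L), (Num.min d (d' / (L + 1))); split; [exact: mulr_ge0| |].
  by rewrite lt_min d0 divr_gt0.
move=> y; rewrite le_min ler_pdivlMr // => /andP[yd yd'].
have hf := h y yd.
apply: le_trans (h' (f y) _) _; last by rewrite -mulrA ler_wpM2l.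
apply: le_trans hf (le_trans _ yd'); rewrite mulrC ler_wpM2l //; lra.
Qed.

Lemma calm_fst (R : realType) (V W : normedZmodType R) (x : V * W) : calm fst x.
Proof.
apply: (@calm_lipschitz _ _ _ 1) => // y.
by rewrite mul1r prod_normE le_max lexx.
Qed.

Lemma calm_snd (R : realType) (V W : normedZmodType R) (x : V * W) : calm snd x.
Proof.
apply: (@calm_lipschitz _ _ _ 1) => // y.
by rewrite mul1r prod_normE le_max lexx orbT.
Qed.

Lemma calm_continuous (R : realType) (V W : normedModType R) (f : V -> W) :
  (forall x, calm f x) -> continuous f.
Proof.
move=> cf x; have [L [d [L0 d0 h]]] := cf x.
apply/cvgrPdist_le => e e0; near=> y.
have yd : `|y - x| <= Num.min d (e / (L + 1)).
  near: y; apply/nbhs_ballP; exists (Num.min d (e / (L + 1))) => /=.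
    by rewrite lt_min d0 divr_gt0 //; lra.
  move=> y; rewrite -ball_normE /= => yx; rewrite distrC; exact: ltW.
move: yd; rewrite le_min => /andP[yd ye].
rewrite ler_pdivlMr in ye; last by lra.
rewrite distrC; apply: le_trans (h y yd) _; apply: le_trans ye.
rewrite mulrC ler_wpM2l //; lra.
Unshelve. all: by end_near.
Qed.

(** * Full measure *)

Section FullMeasure.
Context (R : realType) (m : 'I_3 -> R) (c : R).
Context (m_gt0 : forall i, 0 < m i) (hm12 : m i2 < m i1) (hm23 : m i3 < m i2).
Context (st1 : (1 + gamma m i1 i2) * (1 - gamma m i2 i3) = 1).
Implicit Types (x : state R) (k : collision) (u : R * R * R * R).

Lemma calm_face_coord k x : calm (face_coord k) x.
Proof.
have cp i := calm_pos i x; have cm i := calm_mom i x.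
by case: k; apply: calm_pair; try (apply: calm_pair; try apply: calm_pair);
  try exact: cp; try exact: cm; apply: calmD.
Qed.

Lemma hausdorff_null_face_coord k s (A : set (state R)) : (0 < s)%N ->
  hausdorff_null s A -> hausdorff_null s (face_coord k @` A).
Proof. by move=> s0; apply: hausdorff_null_image => // x _; exact: calm_face_coord. Qed.

Let SR : measurableType _ := g_sigma_algebraType (@open (state R)).

Lemma borel_eq_gt (f g : state R -> R) : continuous f -> continuous g ->
  <<s @open (state R) >> [set x | f x = 0 /\ 0 < g x].
Proof.
move=> cf cg.
have o1 : open [set x | f x != 0].
  have -> : [set x | f x != 0] = f @^-1` (~` [set 0]).
    by apply/seteqP; split=> x /= /eqP.
  by apply: open_comp => [x _|]; [exact: cf|exact: closed_openC (@closed_eq _ 0)].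
have o2 : open [set x | 0 < g x].
  by apply: (@open_comp _ _ g [set y | 0 < y]) => [x _|]; [exact: cg|exact: open_gt].
have m1 : measurable (~` [set x | f x != 0] : set SR).
  by apply: measurableC; exact: sub_sigma_algebra.
have m2 : measurable ([set x | 0 < g x] : set SR) by exact: sub_sigma_algebra.
have -> : [set x | f x = 0 /\ 0 < g x] = ~` [set x | f x != 0] `&` [set x | 0 < g x].
  by apply/seteqP; split=> x /= [h h']; split=> //; [rewrite h eqxx|apply/eqP; move: h => /negP; rewrite negbK].
exact: (measurableI _ _ m1 m2).
Qed.

Lemma borel_strictly_after k : <<s @open (state R) >> [set x | strictly_after m k x].
Proof.
have cp i : continuous (fun x : state R => pos x i).
  by apply: calm_continuous => x; exact: calm_pos.
have cv i : continuous (fun x : state R => vel m x i).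
  by apply: calm_continuous => x; exact: calm_vel.
have cpB i j : continuous (fun x : state R => pos x i - pos x j).
  by apply: calm_continuous => x; apply: calmB; exact: calm_pos.
have cvB i j : continuous (fun x : state R => vel m x i - vel m x j).
  by apply: calm_continuous => x; apply: calmB; exact: calm_vel.
case: k.
- exact: borel_eq_gt (cp i1) (cv i1).
- rewrite (_ : [set x | _] = [set x | pos x i1 - pos x i2 = 0 /\ 0 < vel m x i2 - vel m x i1]).
    exact: borel_eq_gt (cpB _ _) (cvB _ _).
  apply/seteqP; split=> x /= [h h']; split=> //.
  - by rewrite h subrr.
  - by rewrite subr_gt0.
  - by apply/eqP; rewrite -subr_eq0 h.
  - by rewrite -subr_gt0.
- rewrite (_ : [set x | _] = [set x | pos x i2 - pos x i3 = 0 /\ 0 < vel m x i3 - vel m x i2]).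
    exact: borel_eq_gt (cpB _ _) (cvB _ _).
  apply/seteqP; split=> x /= [h h']; split=> //.
  - by rewrite h subrr.
  - by rewrite subr_gt0.
  - by apply/eqP; rewrite -subr_eq0 h.
  - by rewrite -subr_gt0.
Qed.

(** The chart maps its domain, where the kinetic energy is positive, into the strict points of the
    face, so [mu_face] sees only those. *)
Lemma mu_face_null k (N0 N : set (state R)) : hausdorff_null 3 N0 ->
  (forall x, N x -> strictly_after m k x -> N0 x) -> mu_face m c k N = 0%E.
Proof.
move=> hN0 NN0; apply: null_set_ge0_integral => [|[[[a b] d] e] _]; last first.
  by rewrite lee_fin /face_density /liouville normr_ge0.
apply: (@subset_null_set _ _ _ (lebesgue4 R) _ (face_coord k @` N0)); last first.
  apply: lebesgue4_null; apply: hausdorff_nullS => //.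
  exact: hausdorff_null_face_coord.
move=> [[[a b] d] e] [[_ _ K0] /= Nu].
exists (chart m c k (a, b, d, e)); last by rewrite chartK.
apply: NN0 => //; exact: chart_strictly_after.
Qed.

Lemma least_expanding_full_measure : full_measure m c (least_expanding m c).
Proof.
have [N0 [BN0 hN0 mN0]] := hausdorff_null_hull (ltn0Sn 2) (hausdorff_null_all_bad c m_gt0).
(* A grazing point of one face may be strict on another; only the points strict on no face are
   discarded along with [N0]. *)
pose S := [set x | strictly_after m Floor x] `|`
  [set x | strictly_after m Balls12 x] `|` [set x | strictly_after m Balls23 x].
have inS k x : strictly_after m k x -> S x.
  by case: k => h; [left; left|left; right|right].
exists (N0 `|` ~` S); split.
- have mS : measurable (S : set SR).
    by apply: measurableU; [apply: measurableU|]; exact: borel_strictly_after.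
  have mN : measurable (N0 : set SR) by [].
  exact: (measurableU _ _ mN (measurableC mS)).
- by rewrite /mu !(@mu_face_null _ N0) ?adde0 // => x [//|nS] /inS.
- move=> x [xS nLE].
  have [[k sk]|no] := pselect (exists k, strictly_after m k x).
    left; apply: BN0.
    have [n bn] := not_least_expanding m_gt0 hm12 hm23 st1 xS sk nLE.
    by exists n.
  by right => -[[h|h]|h]; apply: no; [exists Floor|exists Balls12|exists Balls23].
Qed.

End FullMeasure.

(** * Paths *)

Section Joined.
Context (R : realType) (V : normedModType R).
Implicit Types (A : set V) (x y : V).

(** Continuity on the whole line avoids the subspace topology of [0, 1] when paths are reversed and
    concatenated. *)
Definition joined A x y : Prop := exists f : R -> V,
  [/\ continuous f, f 0 = x, f 1 = y & forall t, 0 <= t <= 1 -> A (f t)].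

Lemma joined_sym A x y : joined A x y -> joined A y x.
Proof.
move=> [f [cf f0 f1 Af]]; exists (fun t => f (1 - t)); split.
- move=> t; apply: (@continuous_comp _ _ _ (fun t : R => 1 - t) f); last exact: cf.
  apply: calm_continuous => s; apply: calmB; first exact: calm_cst.
  by apply: (@calm_lipschitz _ _ _ 1) => // y'; rewrite mul1r.
- by rewrite subr0.
- by rewrite subrr.
- by move=> t /andP[t0 t1]; apply: Af; apply/andP; split; lra.
Qed.

Lemma joined_trans A x y z : joined A x y -> joined A y z -> joined A x z.
Proof.
move=> [f [cf f0 f1 Af]] [g [cg g0 g1 Ag]].
pose a (t : R) := Num.min (2 * t) 1; pose b (t : R) := Num.max (2 * t - 1) 0.
have ca : continuous a.
  apply: calm_continuous => t; apply: (@calm_lipschitz _ _ _ 2) => // s.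
  rewrite /a; case: (leP (2 * s)) => h; case: (leP (2 * t)) => h';
    case: (ger0P (s - t)) => k; rewrite ler_norml; apply/andP; split; lra.
have cb : continuous b.
  apply: calm_continuous => t; apply: (@calm_lipschitz _ _ _ 2) => // s.
  rewrite /b; case: (leP (2 * s - 1)) => h; case: (leP (2 * t - 1)) => h';
    case: (ger0P (s - t)) => k; rewrite ler_norml; apply/andP; split; lra.
have lo t : t <= 2^-1 -> a t = 2 * t /\ b t = 0.
  by move=> t2; rewrite /a /b; split; [apply: min_l|apply: max_r]; lra.
have hi t : 2^-1 <= t -> a t = 1 /\ b t = 2 * t - 1.
  by move=> t2; rewrite /a /b; split; [apply: min_r|apply: max_l]; lra.
(* The sum is continuous without gluing: one of f (a t), g (b t) is always y. *)
exists (fun t => f (a t) + g (b t) - y); split.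
- move=> t; apply: (@continuousB _ _ _ (fun t => f (a t) + g (b t)) (fun=> y)).
    apply: (@continuousD _ _ _ (f \o a) (g \o b)).
      by apply: continuous_comp; [exact: ca|exact: cf].
    by apply: continuous_comp; [exact: cb|exact: cg].
  exact: cst_continuous.
- have [|-> ->] := lo 0; first by rewrite invr_ge0.
  by rewrite mulr0 f0 g0 addrK.
- have [|-> ->] := hi 1; first by lra.
  by rewrite f1 (_ : 2 * 1 - 1 = 1); [rewrite g1 addrC addKr|ring].
- move=> t /andP[t0 t1]; have [t2|/ltW t2] := leP t 2^-1.
    have [-> ->] := lo t t2; rewrite g0 addrK; apply: Af.
    by apply/andP; split; lra.
  have [-> ->] := hi t t2; rewrite f1 addrC addKr; apply: Ag.
  by apply/andP; split; lra.
Qed.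

End Joined.

(** * Arcwise connectedness *)

Section Connected.
Context (R : realType) (m : 'I_3 -> R) (c : R) (c_gt0 : 0 < c).
Context (m_gt0 : forall i, 0 < m i) (hm12 : m i2 < m i1) (hm23 : m i3 < m i2).
Context (st1 : (1 + gamma m i1 i2) * (1 - gamma m i2 i3) = 1).
Implicit Types (x y : state R) (k : collision) (u p z : R * R * R * R).

Definition segment p z (t : R) : R * R * R * R :=
  (p.1.1.1 + t * (z.1.1.1 - p.1.1.1), p.1.1.2 + t * (z.1.1.2 - p.1.1.2),
   p.1.2 + t * (z.1.2 - p.1.2), p.2 + t * (z.2 - p.2)).

(** If b = p + t (z - p), then z = p + t^-1 (b - p), so the cone is a polynomial image of pairs (b,
    t^-1), one dimension more than [B]. The value t = 0 is excluded, since a vertex in [B] would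
    make every z belong to the cone. *)
Lemma hausdorff_null_cone p (B : set (R * R * R * R)) : hausdorff_null 3 B ->
  hausdorff_null 4 [set z | exists2 t, 0 < t <= 1 & B (segment p z t)].
Proof.
move=> hB.
pose g (w : R * R * R * R * R) := segment p w.1 w.2.
apply: (@hausdorff_null_sub _ _ _ _
  (\bigcup_M (g @` [set w | B w.1 /\ `|w.2| <= M%:R]))).
  move=> z [t /andP[t0 t1] Bt].
  have /andP[_ h] := truncn_itv (normr_ge0 t^-1).
  exists (Num.truncn `|t^-1|).+1 => //; exists (segment p z t, t^-1).
    by split=> //=; exact: ltW.
  have tn : t != 0 by rewrite gt_eqF.
  rewrite /g /segment /=; case: z {Bt} => [[[a b] d] e] /=.
  by congr (_, _, _, _); field.
apply: hausdorff_null_bigcup => // M.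
apply: hausdorff_null_image => // [w _|]; last exact: hausdorff_null_prod.
have cl (h : R * R * R * R -> R) (q : R) : (forall v, calm h v) ->
    calm (fun w : R * R * R * R * R => q + w.2 * (h w.1 - q)) w.
  move=> ch; apply: calmD; first exact: calm_cst.
  apply: calmM; first exact: calm_snd.
  apply: calmB; last exact: calm_cst.
  by apply: (@calm_comp _ _ _ _ fst h) => //; exact: calm_fst.
have c1 v : calm (fun v : R * R * R * R => v.1) v by exact: calm_fst.
have c11 v : calm (fun v : R * R * R * R => v.1.1) v.
  by apply: (calm_comp (c1 v)); exact: calm_fst.
apply: calm_pair; first apply: calm_pair; first apply: calm_pair.
- by apply: (cl (fun v => v.1.1.1)) => v; apply: (calm_comp (c11 v)); exact: calm_fst.
- by apply: (cl (fun v => v.1.1.2)) => v; apply: (calm_comp (c11 v)); exact: calm_snd.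
- by apply: (cl (fun v => v.1.2)) => v; apply: (calm_comp (c1 v)); exact: calm_snd.
- by apply: (cl snd) => v; exact: calm_snd.
Qed.

Lemma continuous_state (f : R -> state R) :
  (forall i, continuous (fun t => pos (f t) i)) ->
  (forall i, continuous (fun t => mom (f t) i)) -> continuous f.
Proof.
move=> cq cp t; apply/cvgrPdist_le => e e0.
have h (g : 'I_3 -> R -> R) : (forall i, continuous (g i)) ->
    \forall s \near t, forall i, `|g i t - g i s| <= e.
  move=> cg; near=> s; apply: all_i3; near: s.
  - by have /cvgrPdist_le := cg i1 t; apply.
  - by have /cvgrPdist_le := cg i2 t; apply.
  - by have /cvgrPdist_le := cg i3 t; apply.
near=> s; apply: state_norm_le => [|i|i]; first exact: ltW.
  by rewrite posB; move: i; near: s; exact: h.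
by rewrite momB; move: i; near: s; exact: h.
Unshelve. all: by end_near.
Qed.

(** At a grazing vertex the kinetic energy vanishes and its square root need not be [calm]; the root
    is therefore treated by mere continuity. *)
Lemma chart_segment_continuous k p z : continuous (fun t => chart m c k (segment p z t)).
Proof.
have cid (t : R) : calm (fun s : R => s) t.
  by apply: (@calm_lipschitz _ _ _ 1) => // s; rewrite mul1r.
have ccst (a t : R) : calm (fun _ : R => a) t by exact: calm_cst.
have ca (a b t : R) : calm (fun s : R => a + s * (b - a)) t.
  by apply: calmD => //; apply: calmM.
have cK t : calm (fun s => kinetic m c k (segment p z s)) t.
  have [A [B [A' [B' [_ _ _ _ KE]]]]] := kineticE c m_gt0 k.
  apply: (calm_ext (g := fun s => _)) => [s|]; first exact: KE.
  rewrite /segment /=.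
  by do ?[apply: calmB => //]; apply: calmD; apply: calmM => //; apply: calmM.
have cS (M : R) : continuous (fun s => Num.sqrt (M * kinetic m c k (segment p z s))).
  move=> t; apply: (@continuous_comp _ _ _ (fun s => M * kinetic m c k (segment p z s)) Num.sqrt).
    by apply: calm_continuous => s; apply: calmM.
  exact: sqrt_continuous.
have cc (f : R -> R) : (forall t, calm f t) -> continuous f by exact: calm_continuous.
pose K t := kinetic m c k (segment p z t).
have affine (q a b d : R) (r : R -> R) : continuous r ->
    continuous (fun s : R => q * (a + s * (b - a)) + d * r s).
  move=> cr t; apply: (@continuousD _ _ _ (fun s : R => q * (a + s * (b - a))) (fun s : R => d * r s)).
    by apply: cc => s; apply: calmM.
  by apply: (@continuousM _ _ (fun=> d) r); [exact: cst_continuous|exact: cr].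
have eqc (f g : R -> R) : f =1 g -> continuous g -> continuous f by move=> /funext ->.
apply: continuous_state; apply: all_i3; case: k @K cS cK => K cS cK.
- by apply: (eqc _ (fun=> 0)) => [t|]; [rewrite /chart /= pos_row3|exact: cst_continuous].
- by apply: (eqc _ (fun s => (segment p z s).1.1.1)) => [t|]; [rewrite /chart /= pos_row3|apply: cc => s; exact: ca].
- by apply: (eqc _ (fun s => (segment p z s).1.1.1)) => [t|]; [rewrite /chart /= pos_row3|apply: cc => s; exact: ca].
- by apply: (eqc _ (fun s => (segment p z s).1.1.1)) => [t|]; [rewrite /chart /= pos_row3|apply: cc => s; exact: ca].
- by apply: (eqc _ (fun s => (segment p z s).1.1.1)) => [t|]; [rewrite /chart /= pos_row3|apply: cc => s; exact: ca].
- by apply: (eqc _ (fun s => (segment p z s).1.2)) => [t|]; [rewrite /chart /= pos_row3|apply: cc => s; exact: ca].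
- by apply: (eqc _ (fun s => (segment p z s).1.2)) => [t|]; [rewrite /chart /= pos_row3|apply: cc => s; exact: ca].
- by apply: (eqc _ (fun s => (segment p z s).1.2)) => [t|]; [rewrite /chart /= pos_row3|apply: cc => s; exact: ca].
- by apply: (eqc _ (fun s => (segment p z s).1.2)) => [t|]; [rewrite /chart /= pos_row3|apply: cc => s; exact: ca].
- apply: (eqc _ (fun s => Num.sqrt (2 * m i1 * K s))) => [t|]; last exact: cS.
  by rewrite /chart /face_chart mom_row3.
- pose r s := Num.sqrt (2 * (m i1 * m i2 / (m i1 + m i2)) * K s).
  apply: (eqc _ (fun s => m i1 / (m i1 + m i2) * (segment p z s).1.1.2 + (-1) * r s)) => [t|].
    by rewrite mulN1r /chart /face_chart mom_row3.
  by apply: affine; exact: cS.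
- by apply: (eqc _ (fun s => (segment p z s).1.1.2)) => [t|]; [rewrite /chart /= mom_row3|apply: cc => s; exact: ca].
- by apply: (eqc _ (fun s => (segment p z s).1.1.2)) => [t|]; [rewrite /chart /= mom_row3|apply: cc => s; exact: ca].
- pose r s := Num.sqrt (2 * (m i1 * m i2 / (m i1 + m i2)) * K s).
  apply: (eqc _ (fun s => m i2 / (m i1 + m i2) * (segment p z s).1.1.2 + 1 * r s)) => [t|].
    by rewrite mul1r /chart /face_chart mom_row3.
  by apply: affine; exact: cS.
- pose r s := Num.sqrt (2 * (m i2 * m i3 / (m i2 + m i3)) * K s).
  apply: (eqc _ (fun s => m i2 / (m i2 + m i3) * (segment p z s).2 + (-1) * r s)) => [t|].
    by rewrite mulN1r /chart /face_chart mom_row3.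
  by apply: affine; exact: cS.
- by apply: (eqc _ (fun s => (segment p z s).2)) => [t|]; [rewrite /chart /= mom_row3|apply: cc => s; exact: ca].
- by apply: (eqc _ (fun s => (segment p z s).2)) => [t|]; [rewrite /chart /= mom_row3|apply: cc => s; exact: ca].
- pose r s := Num.sqrt (2 * (m i2 * m i3 / (m i2 + m i3)) * K s).
  apply: (eqc _ (fun s => m i3 / (m i2 + m i3) * (segment p z s).2 + 1 * r s)) => [t|].
    by rewrite mul1r /chart /face_chart mom_row3.
  by apply: affine; exact: cS.
Qed.

(** Concavity of [kinetic], with the excess over the chord written out. *)
Lemma kinetic_segment k p z (t : R) : 0 <= kinetic m c k p -> 0 < kinetic m c k z ->
  0 < t <= 1 -> 0 < kinetic m c k (segment p z t).
Proof.
move=> Kp Kz /andP[t0 t1].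
have [A [B [A' [B' [A0 _ A'0 _ KE]]]]] := kineticE c m_gt0 k.
have -> : kinetic m c k (segment p z t) = (1 - t) * kinetic m c k p + t * kinetic m c k z
   + t * (1 - t) * (A * (p.1.1.2 - z.1.1.2) ^+ 2 + A' * (p.2 - z.2) ^+ 2).
  by rewrite !KE /segment /=; ring.
have t1' : 0 <= 1 - t by lra.
have h1 : 0 <= (1 - t) * kinetic m c k p by rewrite mulr_ge0.
have h2 : 0 < t * kinetic m c k z by rewrite mulr_gt0.
have h3 : 0 <= t * (1 - t) * (A * (p.1.1.2 - z.1.1.2) ^+ 2 + A' * (p.2 - z.2) ^+ 2).
  apply: mulr_ge0; first by rewrite mulr_ge0 // ltW.
  by rewrite addr_ge0 // mulr_ge0 // sqr_ge0.
lra.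
Qed.

Let Bad : set (state R) := \bigcup_n bad m c n.

Lemma good_least_expanding k x : after_collision m c k x -> strictly_after m k x ->
  ~ Bad x -> least_expanding m c x.
Proof.
move=> hx sx nb; apply: contrapT => nLE; apply: nb.
have xS : section_plus m c x by exists k.
have [n bn] := not_least_expanding m_gt0 hm12 hm23 st1 xS sx nLE.
by exists n.
Qed.

Lemma joined_segment k x z :
  least_expanding m c x -> after_collision m c k x ->
  0 <= z.1.1.1 -> z.1.1.1 <= z.1.2 -> 0 < kinetic m c k z ->
  (forall t, 0 < t <= 1 -> ~ (face_coord k @` Bad) (segment (face_coord k x) z t)) ->
  joined (least_expanding m c) x (chart m c k z).
Proof.
move=> hx kx z1 z13 Kz nb; have [xE p1 p13 Kp] := face_coordK m_gt0 kx.
set p := face_coord k x in xE p1 p13 Kp nb *.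
exists (fun t => chart m c k (segment p z t)); split.
- exact: chart_segment_continuous.
- rewrite -[RHS]xE; congr chart.
  by rewrite /segment !mul0r !addr0; case: (p) => [[[]]].
- congr chart; rewrite /segment !mul1r.
  by case: (z) => [[[a b] d] e] /=; congr (_, _, _, _); ring.
- move=> t /andP[t0 t1].
  (* The starting point may be grazing or bad; it belongs to the set by hypothesis. *)
  have [->|tn] := eqVneq t 0.
    rewrite (_ : segment p z 0 = p) ?xE //.
    by rewrite /segment !mul0r !addr0; case: (p) => [[[]]].
  have t01 : 0 < t <= 1 by rewrite t1 lt_neqAle eq_sym tn t0.
  have Kt := kinetic_segment Kp Kz t01.
  apply: (@good_least_expanding k).
  + apply: (chart_after m_gt0) (ltW Kt); rewrite /segment /=.
      have : 0 <= (1 - t) * p.1.1.1 by rewrite mulr_ge0 //; lra.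
      have : 0 <= t * z.1.1.1 by rewrite mulr_ge0.
      lra.
    have : (1 - t) * p.1.1.1 <= (1 - t) * p.1.2 by rewrite ler_wpM2l //; lra.
    have : t * z.1.1.1 <= t * z.1.2 by rewrite ler_wpM2l.
    lra.
  + exact: chart_strictly_after.
  + by move=> bad; apply: (nb t t01); exists (chart m c k (segment p z t)); rewrite ?chartK.
Qed.

(* Two points of a face are joined through a generic third one, as the cones
   with these vertices over the bad set are Lebesgue-null. *)
Lemma joined_face k x y :
  least_expanding m c x -> after_collision m c k x ->
  least_expanding m c y -> after_collision m c k y ->
  joined (least_expanding m c) x y.
Proof.
move=> hx kx hy ky.
have nB : hausdorff_null 3 (face_coord k @` Bad).
  by apply: hausdorff_null_face_coord => //; exact: hausdorff_null_all_bad.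
have [A [B [A' [B' [A0 B0 A'0 B'0 KE]]]]] := kineticE c m_gt0 k.
(* The cube over (0, 0, d, 0) has first coordinate at most d and third coordinate between d and 2 d,
   which orders the positions and explains the factor 2; d <= 1 bounds squares by d, and the summand
   1 makes the kinetic energy strictly positive. *)
pose C := A + B + A' + 2 * B' + 1.
have C0 : 0 < C by rewrite /C; lra.
pose d := Num.min 1 (c / C).
have d0 : 0 < d by rewrite lt_min ltr01 divr_gt0.
have d1 : d <= 1 by rewrite ge_min lexx.
have dC : d * C <= c by rewrite -ler_pdivlMr // ge_min lexx orbT.
have := hausdorff_nullU (ltn0Sn 3) (hausdorff_null_cone (face_coord k x) nB)
   (hausdorff_null_cone (face_coord k y) nB).
move=> /(box4_not_null (0, 0, d, 0) d0)[z].
rewrite /box4 /= !in_itv /= !add0r => -[[[/andP[z1 z1'] /andP[z2 z2']] /andP[z3 z3']] /andP[z4 z4']].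
move=> nz; have [nx ny] : (forall t, 0 < t <= 1 -> ~ (face_coord k @` Bad) (segment (face_coord k x) z t)) /\
   (forall t, 0 < t <= 1 -> ~ (face_coord k @` Bad) (segment (face_coord k y) z t)).
  by split=> t t01 bt; apply: nz; [left|right]; exists t.
have z13 : z.1.1.1 <= z.1.2 by lra.
have sq (v : R) : 0 <= v -> v <= d -> v ^+ 2 <= d.
  by move=> v0 vd; rewrite expr2; apply: (le_trans _ vd); rewrite ler_piMl //; lra.
have Kz : 0 < kinetic m c k z.
  rewrite KE.
  have h1 : A * z.1.1.2 ^+ 2 <= A * d by rewrite ler_wpM2l // sq.
  have h2 : B * z.1.1.1 <= B * d by rewrite ler_wpM2l.
  have h3 : A' * z.2 ^+ 2 <= A' * d by rewrite ler_wpM2l // sq.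
  have h4 : B' * z.1.2 <= B' * (d + d) by rewrite ler_wpM2l.
  move: dC; rewrite /C; lra.
apply: (@joined_trans _ _ _ _ (chart m c k z)).
  exact: joined_segment.
by apply: joined_sym; exact: joined_segment.
Qed.

(** To pass between faces, a good point in the intersection of two faces is wanted. Such an
    intersection, with q_1 = q_2 = 0 or q_1 = q_2 = q_3, is three-dimensional and parametrised by
    the velocities, and the velocities of bad states form a null set for dimension 3. A dummy fourth
    coordinate makes the argument with cubes applicable. *)
Lemma generic_velocities : exists v1 v2 v3 : R, [/\ 0 < v1, v1 < v2, v2 < v3,
  m i1 * v1 ^+ 2 / 2 + m i2 * v2 ^+ 2 / 2 + m i3 * v3 ^+ 2 / 2 <= c &
  forall x, vel m x i1 = v1 -> vel m x i2 = v2 -> vel m x i3 = v3 -> ~ Bad x].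
Proof.
pose rho x : R * R * R := (vel m x i1, vel m x i2, vel m x i3).
have nB : hausdorff_null 3 (rho @` Bad).
  apply: hausdorff_null_image => // [x _|]; last exact: hausdorff_null_all_bad.
  by do ?apply: calm_pair; exact: calm_vel.
have nB4 := hausdorff_null_prod 1 (ltn0Sn 2) nB.
have [m1 m2 m3] : [/\ 0 < m i1, 0 < m i2 & 0 < m i3] by split; apply: m_gt0.
(* The velocities are taken in [d, 2 d], [3 d, 4 d] and [5 d, 6 d], hence are increasing, and v^2 /
   2 <= 18 d^2 <= 18 d. *)
pose C := 18 * (m i1 + m i2 + m i3).
have C0 : 0 < C by rewrite mulr_gt0 // !addr_gt0.
pose d := Num.min 1 (c / C).
have d0 : 0 < d by rewrite lt_min ltr01 divr_gt0.
have d1 : d <= 1 by rewrite ge_min lexx.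
have dC : d * C <= c by rewrite -ler_pdivlMr // ge_min lexx orbT.
have [u] := box4_not_null (d, 3 * d, 5 * d, 0) d0 nB4.
rewrite /box4 /= !in_itv /= !add0r => -[[[/andP[z1 z1'] /andP[z2 z2']] /andP[z3 z3']] /andP[z4 z4']] nu.
exists u.1.1.1, u.1.1.2, u.1.2; split; [lra|lra|lra| |].
  have sq (v M : R) : 0 < M -> 0 <= v -> v <= 6 * d -> M * v ^+ 2 / 2 <= M * (18 * d).
    move=> M0 v0 vd; rewrite -mulrA ler_pM2l //.
    have : v ^+ 2 <= (6 * d) ^+ 2 by rewrite ler_sqr ?nnegrE //; lra.
    have : d * d <= d by rewrite ger_pMl.
    rewrite exprMn [d ^+ 2]expr2; lra.
  have h1 : m i1 * u.1.1.1 ^+ 2 / 2 <= m i1 * (18 * d) by apply: sq; lra.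
  have h2 : m i2 * u.1.1.2 ^+ 2 / 2 <= m i2 * (18 * d) by apply: sq; lra.
  have h3 : m i3 * u.1.2 ^+ 2 / 2 <= m i3 * (18 * d) by apply: sq; lra.
  move: dC; rewrite /C; lra.
move=> x e1 e2 e3 bx; apply: nu; split; last by rewrite ger0_norm //; lra.
by exists x => //; rewrite /rho e1 e2 e3; case: (u) => [[[]]].
Qed.

Lemma least_expanding_connected : arcwise_connected (least_expanding m c).
Proof.
have [v1 [v2 [v3 [v10 v12 v23 Kc nb]]]] := generic_velocities.
have [m1 m2 m3] : [/\ 0 < m i1, 0 < m i2 & 0 < m i3] by split; apply: m_gt0.
set K := _ + _ + _ in Kc.
(* With the heights given by the energy, [w 0 q] lies on the faces [Floor] and [Balls12], and
   [w q' q'] on [Balls12] and [Balls23]; together they link the three faces. *)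
pose w (a b : R) : state R := (row3 a a b, row3 (m i1 * v1) (m i2 * v2) (m i3 * v3)).
have wv a b : [/\ vel m (w a b) i1 = v1, vel m (w a b) i2 = v2 & vel m (w a b) i3 = v3].
  by rewrite /vel !mom_row3 !(mulrC (m _)) !mulfK // gt_eqF.
have wH a b : (m i1 + m i2) * a + m i3 * b = c - K -> hamiltonian m (w a b) = c.
  move=> h; rewrite (hamiltonian_velE m_gt0); have [-> -> ->] := wv a b.
  by rewrite !pos_row3 -[RHS](subrK K) -h /K; field.
pose q := (c - K) / m i3; pose q' := (c - K) / (m i1 + m i2 + m i3).
have q0 : 0 <= q by rewrite divr_ge0 ?subr_ge0 // ltW.
have M0 : 0 < m i1 + m i2 + m i3 by rewrite !addr_gt0.
have q'0 : 0 <= q' by rewrite divr_ge0 ?subr_ge0 // ltW.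
have E1 : energy_level m c (w 0 q).
  split; last by rewrite !pos_row3.
  by apply: wH; rewrite mulr0 add0r mulrC divfK // gt_eqF.
have E2 : energy_level m c (w q' q').
  split; last by rewrite !pos_row3.
  by apply: wH; rewrite -mulrDl mulrC divfK // gt_eqF.
have [a1 a2 a3] := wv 0 q; have [b1 b2 b3] := wv q' q'.
have f1 : after_collision m c Floor (w 0 q).
  by split=> //; rewrite a1 pos_row3; split=> //; exact: ltW.
have f2 : after_collision m c Balls12 (w 0 q).
  by split=> //; rewrite a1 a2 !pos_row3; split=> //; exact: ltW.
have g2 : after_collision m c Balls12 (w q' q').
  by split=> //; rewrite b1 b2 !pos_row3; split=> //; exact: ltW.
have g3 : after_collision m c Balls23 (w q' q').
  by split=> //; rewrite b2 b3 !pos_row3; split=> //; exact: ltW.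
have L1 : least_expanding m c (w 0 q).
  apply: (@good_least_expanding Floor) => //; last exact: nb.
  by rewrite /= a1 pos_row3.
have L2 : least_expanding m c (w q' q').
  apply: (@good_least_expanding Balls12) => //; last exact: nb.
  by rewrite /= b1 b2 !pos_row3.
have toL1 x : least_expanding m c x -> joined (least_expanding m c) x (w 0 q).
  move=> hx; case: (hx) => -[k _ kx] _; case: k kx => kx.
  - exact: (joined_face hx kx L1 f1).
  - exact: (joined_face hx kx L1 f2).
  - exact: (joined_trans (joined_face hx kx L2 g3) (joined_face L2 g2 L1 f2)).
move=> x y hx hy.
have [f [cf f0 f1' Af]] := joined_trans (toL1 x hx) (joined_sym (toL1 y hy)).
exists f; split=> //; exact: continuous_subspaceT.
Qed.

End Connected.

Theorem mainTheorem3 (R : realType) (m : 'I_3 -> R) (c : R)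
    (hm12 : m i2 < m i1) (hm23 : m i3 <= m i2) (hm3 : 0 < m i3)
    (hm : 2 * Num.sqrt (m i1) * Num.sqrt (m i3) =
          Num.sqrt (m i1 + m i2) * Num.sqrt (m i2 + m i3))
    (hc : 0 < c) :
  full_measure m c (least_expanding m c) /\
  arcwise_connected (least_expanding m c).
Proof.
have [m_gt0 hm23' st1] := mass_condition hm12 hm23 hm3 hm.
by split; [exact: least_expanding_full_measure|exact: least_expanding_connected].
Qed.
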